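(* (Rellich–Kondrachov) The embedding $H_{1,W}(\mathbb T^d)\subset L^2(\mathbb T^d)$ is compact.
   Context: $\mathbb T=\mathbb R/\mathbb Z=[0,1)$ and $\mathbb T^d=[0,1)^d$. $W(x)=\sum_{k=1}^dW_k(x_k)$, where each $W_k:\mathbb R\to\mathbb R$ is strictly increasing, right continuous with left limits, and satisfies $W_k(u+1)-W_k(u)=W_k(1)-W_k(0)$ for all $u$. $dW_k$ is the measure induced by $W_k$ on $\mathbb T$. The generalized derivative is $\partial_{W_k}f(x)=\lim_{\epsilon\to0}\frac{f(x+\epsilon e_k)-f(x)}{W_k(x_k+\epsilon)-W_k(x_k)}$ when the limit exists and is finite. One-dimensional operator: $\mathcal D_{W_k}$ is the set of $f\in L^2(\mathbb T)$ of the form $f(x)=a+bW_k(x)+\int_{(0,x]}W_k(dy)\int_0^y\mathfrak f(z)\,dz$ with $\mathfrak f\in L^2(\mathbb T)$, $\int_0^1\mathfrak f(z)\,dz=0$ and $\int_{(0,1]}W_k(dy)\{b+\int_0^y\mathfrak f(z)\,dz\}=0$; on $\mathcal D_{W_k}$, $\mathcal L_{W_k}f=\partial_{x_k}\partial_{W_k}f$ (with $\partial_{W_k}f(x)=b+\int_0^x\mathfrak f(z)\,dz$ and $\mathcal L_{W_k}f=\mathfrak f$). $\mathcal A_{W_k}$ is a countable complete orthonormal system of $L^2(\mathbb T)$ consisting of eigenvectors of $\mathcal L_{W_k}$. $\mathcal A_W=\{f:\ f(x)=\prod_{k=1}^df_k(x_k),\ f_k\in\mathcal A_{W_k}\}$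 and $\mathbb D_W=\mathrm{span}(\mathcal A_W)$. For $f\in\mathbb D_W$, $\partial_{W_i}f$ and $\partial_{x_i}\partial_{W_i}f$ act on the $i$th coordinate with the others fixed. $d(x^i\otimes W_i)=dx_1\cdots dx_{i-1}\,dW_i\,dx_{i+1}\cdots dx_d$ on $\mathbb T^d$; $L^2_{x^i\otimes W_i}(\mathbb T^d)$ is the corresponding $L^2$ space, and $L^2_{x^i\otimes W_i,0}(\mathbb T^d)$ is its closed subspace of functions $f$ with zero mean, $\int_{\mathbb T^d}f\,d(x^i\otimes W_i)=0$. The $W$-Sobolev space $H_{1,W}(\mathbb T^d)$ is the set of $g\in L^2(\mathbb T^d)$ such that for each $i=1,\dots,d$ there is $G_i\in L^2_{x^i\otimes W_i,0}(\mathbb T^d)$ with $\int_{\mathbb T^d}(\partial_{x_i}\partial_{W_i}f)\,g\,dx=-\int_{\mathbb T^d}(\partial_{W_i}f)\,G_i\,d(x^i\otimes W_i)$ for all $f\in\mathbb D_W$; the (unique) $G_i$ is denoted $\partial_{W_i}g$. Its norm $\|\cdot\|_{1,W}$ is induced by $\langle f,g\rangle_{1,W}=\int_{\mathbb T^d}fg\,dx+\sum_{i=1}^d\int_{\mathbb T^d}(\partial_{W_i}f)(\partial_{W_i}g)\,d(x^i\otimes W_i)$. *)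

(* Defs.v *)
From HB Require Import structures.
From mathcomp Require Import all_boot all_order all_algebra.
From mathcomp Require Import all_classical all_reals all_analysis.

Set Implicit Arguments.
Unset Strict Implicit.
Unset Printing Implicit Defensive.

Import Order.TTheory GRing.Theory Num.Theory.
Import numFieldNormedType.Exports.

Local Open Scope classical_set_scope.
Local Open Scope ring_scope.

(* Product of n finite measures on n.-tuple T, by recursion on n: the binary
   product of the first measure with the product of the others is transported
   along (x, (x_1, ..., x_n)) |-> (x, x_1, ..., x_n). *)
Section cons_measure.
Local Open Scope ereal_scope.
Context d (T : measurableType d) (R : realType) (n : nat).
Variables (m1 : {finite_measure set T -> \bar R})
          (m2 : {finite_measure set (n.-tuple T) -> \bar R}).

Definition cons_pair (p : T * n.-tuple T) : n.+1.-tuple T :=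
  [the n.+1.-tuple T of p.1 :: p.2].

Lemma measurable_cons_pair : measurable_fun [set: T * n.-tuple T] cons_pair.
Proof. exact: measurable_cons. Qed.

Definition cons_measure : set (n.+1.-tuple T) -> \bar R :=
  pushforward (m1 \x m2) cons_pair.

Let cons_measure0 : cons_measure set0 = 0.
Proof. by rewrite /cons_measure /pushforward preimage_set0 (measure0 (m1 \x m2)). Qed.

Let cons_measure_ge0 A : 0 <= cons_measure A.
Proof. exact: (measure_ge0 (m1 \x m2)). Qed.

Let cons_measure_sigma_additive : semi_sigma_additive cons_measure.
Proof.
move=> F mF tF mUF; rewrite /cons_measure /pushforward preimage_bigcup.
have mpre A : measurable A -> measurable (cons_pair @^-1` A).
  by move=> mA; rewrite -[X in measurable X]setTI; exact: measurable_cons_pair.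
apply: (measure_semi_sigma_additive (s := m1 \x m2)).
- by move=> k; exact: mpre.
- apply/trivIsetP => /= i j _ _ ij; rewrite -preimage_setI.
  by move/trivIsetP : tF => /(_ _ _ _ _ ij) ->//; rewrite preimage_set0.
- by rewrite -preimage_bigcup; exact: mpre.
Qed.

HB.instance Definition _ := isMeasure.Build _ _ _
  cons_measure cons_measure0 cons_measure_ge0 cons_measure_sigma_additive.

Let cons_measure_fin : fin_num_fun cons_measure.
Proof.
have fin : cons_measure setT < +oo.
  rewrite /cons_measure /pushforward (_ : _ @^-1` _ = setT `*` setT).
    rewrite product_measure1E// -ge0_fin_numE ?mule_ge0//.
    by rewrite fin_numM ?fin_num_measure.
  by rewrite setXTT.
move=> A mA; rewrite ge0_fin_numE//; apply: le_lt_trans fin.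
by apply: le_measure; rewrite ?inE.
Qed.

HB.instance Definition _ :=
  Measure_isFinite.Build _ _ _ cons_measure cons_measure_fin.

End cons_measure.

Fixpoint tuple_measure d (T : measurableType d) (R : realType) (n : nat) :
    ('I_n -> {finite_measure set T -> \bar R}) ->
    {finite_measure set (n.-tuple T) -> \bar R} :=
  match n return ('I_n -> {finite_measure set T -> \bar R}) ->
                 {finite_measure set (n.-tuple T) -> \bar R} with
  | 0 => fun _ => dirac [tuple]
  | n'.+1 => fun m =>
      cons_measure (m ord0) (tuple_measure (fun i => m (lift ord0 i)))
  end.

Section torus.
Context (R : realType).

(* The circle is represented by the fundamental domain [0, 1): its measures are
   measures on R carried by [0, 1), so functions are identified almost
   everywhere there and their values elsewhere are irrelevant. *)

Lemma lebesgue_stieltjes_measure_unit_lty (V : cumulative R R) :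
  (lebesgue_stieltjes_measure V `[0%R, 1%R[%classic < +oo)%E.
Proof.
apply: (@le_lt_trans _ _ (lebesgue_stieltjes_measure V `](- 1)%R, 1%R]%classic)).
  apply: le_measure; rewrite ?inE; [exact: measurable_itv|exact: measurable_itv|].
  move=> x /=; rewrite !in_itv/= => /andP[x0 /ltW ->]; rewrite andbT.
  by rewrite (lt_le_trans _ x0)// ltrN10.
rewrite /lebesgue_stieltjes_measure /measure_extension/=.
rewrite measurable_mu_extE/=; last exact: is_ocitv.
by rewrite wlength_itv_bnd ?ltry// (le_trans (lerN10 R)).
Qed.

Let measurable_unit :
  measurable (`[0%R, 1%R[%classic : set (measurableTypeR R)).
Proof. exact: measurable_itv. Qed.

Definition dW (V : cumulative R R) :
    {finite_measure set (measurableTypeR R) -> \bar R} :=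
  mfrestr measurable_unit (lebesgue_stieltjes_measure_unit_lty V).

Definition dx : {finite_measure set (measurableTypeR R) -> \bar R} := dW idfun.

Definition torus (d : nat) := d.-tuple (measurableTypeR R).

Definition dx_torus (d : nat) : {finite_measure set (torus d) -> \bar R} :=
  tuple_measure (fun _ => dx).

(* d(x^i \otimes W_i) *)
Definition dxW (d : nat) (W : 'I_d -> cumulative R R) (i : 'I_d) :
    {finite_measure set (torus d) -> \bar R} :=
  tuple_measure (fun j => if j == i then dW (W i) else dx).

Definition coord (d : nat) (x : torus d) (i : 'I_d) : R := tnth x i.

(* x + h e_i *)
Definition translate (d : nat) (x : torus d) (i : 'I_d) (h : R) : torus d :=
  [tuple (coord x j + h *+ (j == i)) | j < d].

(* [lim] takes a default value at the points where the limit does not exist. *)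
Definition gderive (d : nat) (V : R -> R) (i : 'I_d) (f : torus d -> R)
    (x : torus d) : R :=
  lim ((fun h : R => (f (translate x i h) - f x) /
                     (V (coord x i + h) - V (coord x i))) @ 0^').

Definition partialW (d : nat) (W : 'I_d -> cumulative R R) (i : 'I_d)
    (f : torus d -> R) : torus d -> R := gderive (W i) i f.

Definition partialx (d : nat) (i : 'I_d) (f : torus d -> R) : torus d -> R :=
  gderive idfun i f.

(* Graph of the one-dimensional operator: f is in the domain and is mapped to
   ff. Unlike other functions on the circle, f is a pointwise-defined, 1-periodic
   representative, so that difference quotients at points of [0, 1) make sense
   across the endpoints. *)
Definition opLW (V : cumulative R R) (f ff : R -> R) : Prop :=
  [/\ f \in Lfun dx 2%:E, ff \in Lfun dx 2%:E,
      (forall x, f (x + 1) = f x),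
      \int[lebesgue_measure]_(z in `[0, 1]) ff z = 0 &
      exists a b : R,
        \int[lebesgue_stieltjes_measure V]_(y in `]0, 1])
          (b + \int[lebesgue_measure]_(z in `[0, y]) ff z) = 0 /\
        forall x, 0 <= x < 1 ->
          f x = a + b * V x +
            \int[lebesgue_stieltjes_measure V]_(y in `]0, x])
              \int[lebesgue_measure]_(z in `[0, y]) ff z].

Definition eigenvector (V : cumulative R R) (f : R -> R) : Prop :=
  ~ {ae dx, forall x, f x = 0} /\
  exists lambda : R, opLW V f (fun x => lambda * f x).

Definition complete_orthonormal_system (A : set (R -> R)) : Prop :=
  [/\ forall f, A f -> f \in Lfun dx 2%:E,
      forall f, A f -> \int[dx]_x (f x ^+ 2) = 1,
      forall f g, A f -> A g -> f <> g -> \int[dx]_x (f x * g x) = 0 &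
      forall h : R -> R, h \in Lfun dx 2%:E ->
        (forall f, A f -> \int[dx]_x (f x * h x) = 0) ->
        {ae dx, forall x, h x = 0}].

Definition eigenbasis (V : cumulative R R) (A : set (R -> R)) : Prop :=
  [/\ countable A, complete_orthonormal_system A &
      forall f, A f -> eigenvector V f].

Definition tensor_basis (d : nat) (A : 'I_d -> set (R -> R)) :
    set (torus d -> R) :=
  [set f | exists2 phi : 'I_d -> R -> R, (forall k, A k (phi k)) &
             f = fun x => \prod_(k < d) phi k (coord x k)].

Definition span_set (T : Type) (B : set (T -> R)) : set (T -> R) :=
  [set f | exists (n : nat) (c : 'I_n -> R) (p : 'I_n -> T -> R),
             (forall j, B (p j)) /\ f = fun x => \sum_(j < n) c j * p j x].

Definition D_W (d : nat) (A : 'I_d -> set (R -> R)) : set (torus d -> R) :=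
  span_set (tensor_basis A).

Definition L2_dxW0 (d : nat) (W : 'I_d -> cumulative R R) (i : 'I_d) :
    set (torus d -> R) :=
  [set G | G \in Lfun (dxW W i) 2%:E /\ \int[dxW W i]_x G x = 0].

Definition weak_partialW (d : nat) (W : 'I_d -> cumulative R R)
    (A : 'I_d -> set (R -> R)) (i : 'I_d) (g G : torus d -> R) : Prop :=
  L2_dxW0 W i G /\
  forall f, D_W A f ->
    \int[dx_torus d]_x (partialx i (partialW W i f) x * g x) =
    - \int[dxW W i]_x (partialW W i f x * G x).

Definition H1W (d : nat) (W : 'I_d -> cumulative R R)
    (A : 'I_d -> set (R -> R)) : set (torus d -> R) :=
  [set g | g \in Lfun (dx_torus d) 2%:E /\
           forall i, exists G, weak_partialW W A i g G].

(* The weak derivatives Df and Dg of f and g are explicit arguments, so that no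
   choice among weak derivatives is built into the norm. *)
Definition H1W_dot (d : nat) (W : 'I_d -> cumulative R R)
    (f : torus d -> R) (Df : 'I_d -> torus d -> R)
    (g : torus d -> R) (Dg : 'I_d -> torus d -> R) : R :=
  \int[dx_torus d]_x (f x * g x) +
  \sum_(i < d) \int[dxW W i]_x (Df i x * Dg i x).

Definition H1W_norm (d : nat) (W : 'I_d -> cumulative R R)
    (g : torus d -> R) (Dg : 'I_d -> torus d -> R) : R :=
  Num.sqrt (H1W_dot W g Dg g Dg).

Definition cvg_L2 (d : nat) (u : nat -> torus d -> R) (h : torus d -> R) :=
  ('N[dx_torus d]_2%:E[(fun x => (u n x - h x)%:E)])%E @[n --> \oo] --> 0%E.

(* Compactness of the embedding of H_{1,W} into L^2: every sequence bounded in
   H_{1,W} has a subsequence that converges in L^2. *)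
Definition H1W_compact_embedding (d : nat) (W : 'I_d -> cumulative R R)
    (A : 'I_d -> set (R -> R)) : Prop :=
  forall (g : nat -> torus d -> R) (Dg : nat -> 'I_d -> torus d -> R) (M : R),
    (forall n, H1W W A (g n)) ->
    (forall n i, weak_partialW W A i (g n) (Dg n i)) ->
    (forall n, H1W_norm W (g n) (Dg n) <= M) ->
    exists (s : nat -> nat) (h : torus d -> R),
      [/\ {homo s : m n / (m < n)%N}, h \in Lfun (dx_torus d) 2%:E &
          cvg_L2 (g \o s) h].

End torus.

(* Main.v *)
Require Import Defs.
From mathcomp Require Import all_boot all_order all_algebra.
From mathcomp Require Import all_classical all_reals all_analysis.
From mathcomp Require Import measurable_realfun ring lra.

Set Implicit Arguments.
Unset Strict Implicit.
Unset Printing Implicit Defensive.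

Import Order.TTheory GRing.Theory Num.Theory.
Import numFieldNormedType.Exports.

Local Open Scope classical_set_scope.
Local Open Scope ring_scope.

(** Write [e_a] for the tensor products of the one-dimensional eigenfunctions
    and [- nu_j] for the eigenvalues of the k-th operator. Integration by parts
    shows that the fluxes [d_{W_k} e_j] are orthogonal in [L^2(dW_k)] with
    squared norms [nu_j]. Two applications of Bessel's inequality to fluxes
    then carry the proof:
    - against the indicators of [(0, x]], integrated over [x], it gives
      [\sum_j 1 / nu_j <= W_k(1) - W_k(0)] over the [nu_j <> 0], so that the
      [nu_j] tend to infinity, [nu_j = 0] being left to constants;
    - against the weak derivative [G_i] of [g], it gives
      [\sum_a nu_{a_i} <e_a, g>^2 <= |G_i|^2].
    A ball of the Sobolev space therefore has uniformly small Fourier tails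
    along the complete orthonormal system [e_a], and is relatively compact. *)

(** * The semi-inner product of L^2 *)

(** The bases are arbitrary orthonormal systems of eigenvectors and [W_k] may jump, so neither the
    growth of the eigenvalues nor the calculus of the fluxes comes for free. Growth is extracted
    from the finite mass of [dW_k], because an increment of an eigenfunction is an inner product of
    its flux with an indicator. Integration by parts is Fubini on [z < y], where the atoms of [dW_k]
    at 0 and 1 are matched by periodicity. The operators on the torus are limits with a default
    value, so derivatives of [e_a] must be computed pointwise: the first one wherever the coordinate
    lies in [[0, 1)], since fluxes are continuous; the second only almost everywhere, since it
    differentiates a primitive of an L^2 function. In dimension [d] the fluxes of each direction
    live in their own space [L^2(d(x^i \otimes W_i))] and control a mode [a] only through the entry
    [a_i]. All directions are summed: outside a finite box of multi-indices at least one entry is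
    large. Completeness is asked of the [e_a] in [L^2(dx)]; the fluxes enter as orthogonal systems,
    through Bessel's inequality. *)

Section L2.
Context d (T : measurableType d) (R : realType).
Variable mu : {measure set T -> \bar R}.
Local Notation L2 f := (f \in Lfun mu 2%:E).
Implicit Types (f g h v : T -> R).

Definition dot (f g : T -> R) : R := \int[mu]_x (f x * g x).

Lemma Lfun2_measurable f : L2 f -> measurable_fun setT f.
Proof. by rewrite inE => /andP[/[!inE]]. Qed.

Lemma Lfun2P f : L2 f <->
  measurable_fun setT f /\ mu.-integrable setT (EFin \o (fun x => f x ^+ 2)).
Proof.
split=> [l2f|[mf /integrableP[_ if2]]].
  by split; [exact: Lfun2_measurable|exact: Lfun2_integrable_sqr].
rewrite inE; apply/andP; split; rewrite inE//= /finite_norm unlock poweR_lty//.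
under eq_integral => x _.
  rewrite (_ : (_ `^ _)%E = `|(f x ^+ 2)%:E|%E); first over.
  by rewrite /= powR_mulrn// normrX.
exact: if2.
Qed.

Lemma Lfun2_0 : L2 (0 : T -> R).
Proof. by case: (Lfun_submod_closed mu (lee1n 2)). Qed.

Lemma Lfun2_lin a f g : L2 f -> L2 g -> L2 (a *: f + g).
Proof. by case: (Lfun_submod_closed mu (lee1n 2)) => _; exact. Qed.

Lemma Lfun2D f g : L2 f -> L2 g -> L2 (f + g).
Proof. by move=> lf lg; rewrite -[f]scale1r; exact: Lfun2_lin. Qed.

Lemma Lfun2Z a f : L2 f -> L2 (a *: f).
Proof. by move=> lf; rewrite -[_ *: f]addr0 Lfun2_lin ?Lfun2_0. Qed.

Lemma Lfun2B f g : L2 f -> L2 g -> L2 (f - g).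
Proof. by move=> lf lg; rewrite -scaleN1r addrC Lfun2_lin. Qed.

Lemma Lfun2_sum n (f : nat -> T -> R) : (forall i, L2 (f i)) ->
  L2 (\sum_(i < n) f i).
Proof.
move=> lf; elim: n => [|n ih]; first by rewrite big_ord0 Lfun2_0.
by rewrite big_ord_recr/= Lfun2D.
Qed.

Lemma Lfun2_mul_integrable f g : L2 f -> L2 g ->
  mu.-integrable setT (EFin \o (fun x => f x * g x)).
Proof. by move=> lf lg; apply/Lfun1_integrable; exact: Lfun2_mul_Lfun1. Qed.

Lemma dotC f g : dot f g = dot g f.
Proof. by apply: eq_Rintegral => x _; rewrite mulrC. Qed.

Lemma dotDl f g h : L2 f -> L2 g -> L2 h -> dot (f + g) h = dot f h + dot g h.
Proof.
move=> lf lg lh; rewrite /dot -RintegralD ?Lfun2_mul_integrable//.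
by apply: eq_Rintegral => x _; rewrite -mulrDl.
Qed.

Lemma dotZl a f g : L2 f -> L2 g -> dot (a *: f) g = a * dot f g.
Proof.
move=> lf lg; rewrite /dot -RintegralZl ?Lfun2_mul_integrable//.
by apply: eq_Rintegral => x _; rewrite mulrA.
Qed.

Lemma dotZr a f g : L2 f -> L2 g -> dot f (a *: g) = a * dot f g.
Proof. by move=> lf lg; rewrite dotC dotZl// dotC. Qed.

Lemma dotBl f g h : L2 f -> L2 g -> L2 h -> dot (f - g) h = dot f h - dot g h.
Proof.
by move=> lf lg lh; rewrite -scaleN1r dotDl ?Lfun2Z// dotZl// mulN1r.
Qed.

Lemma dotBr f g h : L2 f -> L2 g -> L2 h -> dot h (f - g) = dot h f - dot h g.
Proof. by move=> lf lg lh; rewrite dotC dotBl// !(dotC h). Qed.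

Lemma dot0l f : dot 0 f = 0.
Proof.
by rewrite /dot; under eq_Rintegral do rewrite mul0r; rewrite Rintegral_cst// mul0r.
Qed.

Lemma dot_suml n (c : nat -> R) (f : nat -> T -> R) g : (forall i, L2 (f i)) ->
  L2 g -> dot (\sum_(i < n) c i *: f i) g = \sum_(i < n) c i * dot (f i) g.
Proof.
move=> lf lg; elim: n => [|n ih]; first by rewrite !big_ord0 dot0l.
rewrite !big_ord_recr/= dotDl ?ih ?dotZl ?Lfun2Z//.
by apply: (@Lfun2_sum n (fun i => c i *: f i)) => i; exact: Lfun2Z.
Qed.

Lemma dot_ge0 f : 0 <= dot f f.
Proof. by apply: Rintegral_ge0 => x _; rewrite -expr2 sqr_ge0. Qed.

Lemma dot_subE f g : L2 f -> L2 g ->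
  dot (f - g) (f - g) = dot f f - 2 * dot f g + dot g g.
Proof.
move=> lf lg; rewrite dotBl ?dotBr ?Lfun2B// (dotC g f); ring.
Qed.

Lemma dot_addE f g : L2 f -> L2 g ->
  dot (f + g) (f + g) = dot f f + 2 * dot f g + dot g g.
Proof.
move=> lf lg; rewrite dotDl ?Lfun2D// ![dot _ (f + g)]dotC !dotDl// (dotC g f); ring.
Qed.

Lemma dot_sub_le f g h : L2 f -> L2 g -> L2 h ->
  dot (f - h) (f - h) <= 2 * dot (f - g) (f - g) + 2 * dot (g - h) (g - h).
Proof.
move=> lf lg lh.
have := dot_ge0 ((f - g) - (g - h)).
rewrite dot_subE ?Lfun2B// => h0.
rewrite (_ : f - h = (f - g) + (g - h)); last by rewrite addrA subrK.
rewrite dot_addE ?Lfun2B//; lra.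
Qed.

Lemma dot_subC f g : dot (f - g) (f - g) = dot (g - f) (g - f).
Proof.
apply: eq_Rintegral => x _.
by change ((f x - g x) * (f x - g x) = (g x - f x) * (g x - f x)); ring.
Qed.

(** [dot] is only semidefinite, so this degenerate case of Cauchy-Schwarz is proved apart: the
    square norm of [t *: f + g] is affine in [t] and nonnegative, hence its slope vanishes. *)
Lemma dot_norm0 f g : L2 f -> L2 g -> dot f f = 0 -> dot f g = 0.
Proof.
move=> lf lg f0.
have H (t : R) : 0 <= 2 * t * dot f g + dot g g.
  have := dot_ge0 (t *: f + g).
  rewrite dot_addE ?Lfun2Z// !dotZl ?Lfun2Z// (dotC f (t *: f)) dotZl// f0.
  by rewrite !mulr0 add0r mulrA.
apply/eqP/negPn/negP => fg0.
have := H (- (dot g g + 1) / (2 * dot f g)).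
rewrite (_ : 2 * _ * _ + _ = -1); last by field.
lra.
Qed.

Lemma dot_sqr_le f g : L2 f -> L2 g -> dot f g ^+ 2 <= dot f f * dot g g.
Proof.
move=> lf lg; have [f0|f0] := eqVneq (dot f f) 0.
  by rewrite (dot_norm0 lf lg f0) f0 mul0r expr0n.
have := dot_ge0 (dot f f *: g - dot f g *: f).
have fp : 0 < dot f f by rewrite lt_neqAle eq_sym f0 dot_ge0.
rewrite dot_subE ?Lfun2Z// !dotZl ?Lfun2Z// !dotZr// (dotC g f).
set a := dot f f in fp *; set b := dot f g; set c := dot g g.
rewrite (_ : _ + _ = a * (a * c - b ^+ 2)); last by ring.
by rewrite pmulr_rge0// subr_ge0.
Qed.

Lemma dot_eq0_ae f : L2 f -> dot f f = 0 -> {ae mu, forall x, f x = 0}.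
Proof.
move=> lf f0; have := Lfun2_mul_integrable lf lf => iff.
have mff : measurable_fun setT (EFin \o (fun x => f x * f x)) by exact: measurable_int iff.
have : (\int[mu]_x `|(EFin \o (fun x => f x * f x)%R) x| = 0)%E.
  under eq_integral do rewrite gee0_abs ?lee_fin -?expr2 ?sqr_ge0//.
  rewrite -[LHS]fineK; last exact: integrable_fin_num.
  by congr (_%:E).
move/(ae_eq_integral_abs mu measurableT mff); apply: filterS => x /(_ I) /= [].
by move=> /eqP; rewrite mulf_eq0 orbb => /eqP.
Qed.

Lemma Lfun2_normr f : L2 f -> L2 (fun x => `|f x|).
Proof.
move=> /Lfun2P[mf if2]; apply/Lfun2P; split; first exact: measurableT_comp.
by apply: eq_integrable if2 => // x _ /=; rewrite real_normK ?num_real.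
Qed.

(** The bound 1 on the norms, instead of an equality, admits null functions in the system;
    enumerations are padded with them below. *)
Lemma bessel (e : nat -> T -> R) v n : (forall i, L2 (e i)) ->
  (forall i j, i != j -> dot (e i) (e j) = 0) -> (forall i, dot (e i) (e i) <= 1) ->
  L2 v -> \sum_(i < n) dot (e i) v ^+ 2 <= dot v v.
Proof.
move=> le eo e1 lv; pose p := \sum_(i < n) dot (e i) v *: e i.
have lp : L2 p.
  by apply: (@Lfun2_sum n (fun i => dot (e i) v *: e i)) => i; exact: Lfun2Z.
have pE w : L2 w -> dot p w = \sum_(i < n) dot (e i) v * dot (e i) w.
  by move=> lw; exact: (@dot_suml n (fun i => dot (e i) v)).
have pv : dot p v = \sum_(i < n) dot (e i) v ^+ 2 by rewrite pE.
have pp : dot p p <= \sum_(i < n) dot (e i) v ^+ 2.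
  rewrite pE//; apply: ler_sum => i _.
  rewrite (dotC _ p) pE// (bigD1 i)//= big1; last first.
    by move=> j ji; rewrite eo ?mulr0.
  by rewrite addr0 mulrA -expr2 ler_piMr ?sqr_ge0.
by have := dot_ge0 (v - p); rewrite dot_subE// (dotC v p) pv; lra.
Qed.

(** Fluxes are orthogonal but not normalized. A flux of norm zero contributes nothing, since the
    inverse of 0 is 0. *)
Lemma bessel_orthogonal (e : nat -> T -> R) v n : (forall i, L2 (e i)) ->
  (forall i j, i != j -> dot (e i) (e j) = 0) -> L2 v ->
  \sum_(i < n) (dot (e i) (e i))^-1 * dot (e i) v ^+ 2 <= dot v v.
Proof.
move=> le eo lv; pose c i := (Num.sqrt (dot (e i) (e i)))^-1.
have c2 i : c i ^+ 2 = (dot (e i) (e i))^-1 by rewrite exprVn sqr_sqrtr// dot_ge0.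
rewrite (eq_bigr (fun i : 'I_n => dot (c i *: e i) v ^+ 2)) => [|i _].
  apply: (@bessel (fun i => c i *: e i)) => // [i|i j ij|i]; first exact: Lfun2Z.
    by rewrite dotZl ?Lfun2Z// dotZr// eo// !mulr0.
  rewrite dotZl ?Lfun2Z// dotZr// mulrA -expr2 c2.
  have [->|n0] := eqVneq (dot (e i) (e i)) 0; first by rewrite mulr0.
  by rewrite mulVf.
by rewrite dotZl// exprMn c2.
Qed.

End L2.

Section L2_finite.
Context d (T : measurableType d) (R : realType).
Variable mu : {finite_measure set T -> \bar R}.

Lemma Lfun2_cst (c : R) : cst c \in Lfun mu 2%:E. Proof. exact: Lfun_cst. Qed.

Lemma Lfun2_indic (A : set T) : measurable A -> \1_A \in Lfun mu 2%:E.
Proof.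
move=> mA; apply/Lfun2P; split; first exact: measurable_indic.
have : mu.-integrable setT (EFin \o (\1_A : T -> R)) by exact: integrable_indic.
apply: eq_integrable => // x _; rewrite /= indicE.
by case: (x \in A); rewrite ?expr1n ?expr0n.
Qed.

Lemma Lfun2_integrable f : f \in Lfun mu 2%:E -> mu.-integrable setT (EFin \o f).
Proof.
by move=> lf; apply/Lfun1_integrable/Lfun_subset12 => //; exact: fin_num_measure.
Qed.

End L2_finite.

Lemma limn_einf_le_cst (R : realType) (u : (\bar R)^nat) (c : \bar R) :
  (forall n, (u n <= c)%E) -> (limn_einf u <= c)%E.
Proof.
move=> uc; rewrite limn_einf_lim; apply: lime_le; first exact: is_cvg_einfs.
apply: nearW => n; apply: le_trans (uc n); apply: ereal_inf_lbound.
by exists n => /=.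
Qed.

(** * Completeness of L^2 *)

Section riesz_fischer.
Context d (T : measurableType d) (R : realType).
Variable mu : {finite_measure set T -> \bar R}.
Local Notation L2 f := (f \in Lfun mu 2%:E).

(* [|w| <= (2 ^ k w^2 + 2 ^ -k) / 2] makes the increments summable in L^1. *)
Lemma ae_cvg_fast_cauchy (v : nat -> T -> R) : (forall k, L2 (v k)) ->
  (forall k, dot mu (v k.+1 - v k) (v k.+1 - v k) <= (4^-1) ^+ k) ->
  {ae mu, forall x, cvgn (v ^~ x)}.
Proof.
move=> lv vk; pose w k := v k.+1 - v k.
have lw k : L2 (w k) by exact: Lfun2B.
(* Integrating the pointwise bound gives [(2 ^ k * 4 ^ -k + 2 ^ -k * mu setT) / 2]. *)
pose C := (1 + fine (mu setT)) / 2.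
have wint k : (\int[mu]_x `|w k x|%:E <= (C * (2^-1) ^+ k)%:E)%E.
  have iw := Lfun2_integrable (Lfun2_normr (lw k)).
  rewrite -[leLHS]fineK; last exact: integrable_fin_num.
  rewrite lee_fin.
  have i2 := Lfun2_integrable_sqr (lw k).
  have i2' : mu.-integrable setT (EFin \o (fun x => 2 ^+ k / 2 * w k x ^+ 2)).
    exact: (integrableZl measurableT (2 ^+ k / 2) i2).
  have ic : mu.-integrable setT (EFin \o (fun x : T => (2^-1) ^+ k / 2 : R)).
    exact: finite_measure_integrable_cst.
  apply: (@le_trans _ _ (\int[mu]_x (2 ^+ k / 2 * w k x ^+ 2 + (2^-1) ^+ k / 2))).
    apply: le_Rintegral => //; first exact: (integrableD measurableT i2' ic).
    move=> x _; set a := `|w k x|.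
    have -> : w k x ^+ 2 = a ^+ 2 by rewrite real_normK ?num_real.
    have k0 : 0 < 2 ^+ k :> R by rewrite exprn_gt0.
    rewrite exprVn -subr_ge0.
    rewrite (_ : _ - a = (2 ^+ k * a - 1) ^+ 2 / (2 * 2 ^+ k)).
      by rewrite divr_ge0 ?sqr_ge0// mulr_ge0// ltW.
    by field; rewrite gt_eqF.
  rewrite RintegralD// RintegralZl// Rintegral_cst//.
  have -> : \int[mu]_x (w k x ^+ 2) = dot mu (w k) (w k).
    by apply: eq_Rintegral => x _; rewrite expr2.
  have E4 : (4^-1) ^+ k = (2^-1) ^+ k * (2^-1) ^+ k :> R.
    by rewrite -exprMn -invfM; congr (_^-1 ^+ _); ring.
  have k1 : 2 ^+ k * (2^-1) ^+ k = 1 :> R by rewrite -exprMn divff// expr1n.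
  have : 2 ^+ k / 2 * dot mu (w k) (w k) <= (2^-1) ^+ k / 2.
    rewrite mulrAC ler_pM2r//; apply: le_trans (_ : 2 ^+ k * (4^-1) ^+ k <= _).
      by rewrite ler_pM2l ?exprn_gt0//; exact: vk.
    by rewrite E4 mulrA k1 mul1r.
  rewrite /C; lra.
have mw k : measurable_fun setT (fun x => (`|w k x|)%:E).
  by apply/measurable_EFinP; apply: measurableT_comp => //; exact: Lfun2_measurable.
have S0 : (\int[mu]_x \sum_(0 <= k <oo) `|w k x|%:E < +oo)%E.
  rewrite integral_nneseries//.
  apply: (@le_lt_trans _ _ (C * 2)%:E); last by rewrite ltry.
  apply: lime_le; first by apply: is_cvg_nneseries => k _ _; exact: integral_ge0.
  apply: nearW => n; apply: le_trans (_ : ((\sum_(0 <= k < n) (C * 2^-1 ^+ k))%:E <= _)%E).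
    by rewrite -sumEFin; apply: lee_sum => k _; exact: wint.
  rewrite lee_fin -mulr_sumr ler_wpM2l//.
    by rewrite divr_ge0// addr_ge0// fine_ge0.
  have H : series (geometric 1 2^-1) n <= 1 / (1 - 2^-1) :> R.
    by apply: geometric_le_lim; rewrite ?gtr0_norm//; lra.
  rewrite (_ : 1 / (1 - 2^-1) = 2) in H; last by field.
  apply: le_trans H; rewrite /series/= ler_sum// => i _; by rewrite mul1r.
have /integrable_ae : mu.-integrable setT (fun x => \sum_(0 <= k <oo) `|w k x|%:E)%E.
  apply/integrableP; split.
    by apply: ge0_emeasurable_sum => // k x _ _; rewrite lee_fin.
  under eq_integral do rewrite gee0_abs ?nneseries_ge0//.
  by [].
move=> /(_ measurableT); apply: filterS => x /(_ I) xfin.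
have /normed_cvg wc : cvgn [normed series (w ^~ x)].
  apply: nondecreasing_is_cvgn.
    by apply: nondecreasing_series => k _ _; exact: normr_ge0.
  exists (fine (\sum_(0 <= k <oo) `|w k x|%:E)%E) => _ [n _ <-].
  rewrite -lee_fin fineK// /series/= -sumEFin.
  by apply: nneseries_lim_ge => k _ _; rewrite lee_fin.
have -> : v ^~ x = (fun n => v 0%N x + series (w ^~ x) n).
  apply/funext => n; rewrite /series /= (@telescope_sumr _ 0 n (v^~ x))//; ring.
by apply: is_cvgD => //; exact: is_cvg_cst.
Qed.

Lemma riesz_fischer (u : nat -> T -> R) : (forall n, L2 (u n)) ->
  (forall e, 0 < e -> exists N, forall m n, (N <= m)%N -> (N <= n)%N ->
     dot mu (u m - u n) (u m - u n) <= e) ->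
  exists2 h, L2 h & forall e, 0 < e ->
    exists N, forall n, (N <= n)%N -> dot mu (u n - h) (u n - h) <= e.
Proof.
move=> lu cu.
have p4 k : 0 < (4^-1) ^+ k :> R by rewrite exprn_gt0.
have /choice[N hN] : forall k, exists N, forall m n, (N <= m)%N -> (N <= n)%N ->
     dot mu (u m - u n) (u m - u n) <= (4^-1) ^+ k by move=> k; exact: cu.
pose s k := (\sum_(j < k.+1) N j)%N.
have sN k j : (j <= k)%N -> (N j <= s k)%N.
  move=> jk; rewrite /s (bigD1 (inord j))//= inordK// leq_addr//.
have /ae_cvg_fast_cauchy cs : forall k, L2 (u (s k)) by [].
have {}cs : {ae mu, forall x, cvgn (fun k => u (s k) x)}.
  by apply: cs => k; apply: hN; exact: sN.
(* The upper limit is measurable whatever happens on the null set where the subsequence diverges. *)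
pose h x := fine (limn_esup (fun k => (u (s k) x)%:E)).
have mu_ k : measurable_fun setT (u k) by exact: Lfun2_measurable.
have mh : measurable_fun setT h.
  apply: (measurableT_comp (@fine_measurable R setT measurableT)).
  by apply: measurable_fun_limn_esup => k; apply/measurable_EFinP.
have hlim : {ae mu, forall x, u (s k) x @[k --> \oo] --> h x}.
  apply: filterS cs => x cx.
  have /cvg_limn_einf_sup[_ E] :
      (u (s k) x)%:E @[k --> \oo] --> (limn (fun k => u (s k) x))%:E.
    by apply/fine_cvgP; split; [exact: nearW|exact: cx].
  by rewrite /h E.
(* Fatou's lemma carries the Cauchy estimate of level [k] to the limit; the shift by [k] puts every
   index [s (j + k)] beyond [N k]. *)
have bound k n : (N k <= n)%N ->
    (\int[mu]_x ((u n x - h x) ^+ 2)%:E <= ((4^-1) ^+ k)%:E)%E.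
  move=> kn; pose f j x := ((u n x - u (s (j + k)%N) x) ^+ 2)%:E.
  have mf j : measurable_fun setT (f j).
    by apply/measurable_EFinP; apply: measurable_funX; exact: measurable_funB.
  have f0 j x : setT x -> (0 <= f j x)%E by rewrite lee_fin sqr_ge0.
  apply: (@le_trans _ _ (\int[mu]_x limn_einf (f ^~ x))%E).
    apply: ae_ge0_le_integral => //.
    - by move=> x _; rewrite lee_fin sqr_ge0.
    - by apply/measurable_EFinP; apply: measurable_funX; exact: measurable_funB.
    - move=> x _; rewrite limn_einf_lim; apply: lime_ge; first exact: is_cvg_einfs.
      by apply: nearW => j; apply: le_ereal_inf_tmp => _ [i _ <-]; exact: f0.
    - apply: measurableT_comp => //.
      by apply: measurable_fun_limn_esup => j; exact: measurableT_comp.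
    - apply: filterS hlim => x hx _.
      have /cvg_limn_einf_sup[-> _//] : f j x @[j --> \oo] --> ((u n x - h x) ^+ 2)%:E.
      apply/fine_cvgP; split; first exact: nearW.
      have H : u n x - u (s (j + k)%N) x @[j --> \oo] --> u n x - h x.
        apply: cvgB; first exact: cvg_cst.
        by rewrite (@cvg_shiftn k _ (fun k => u (s k) x)).
      rewrite expr2; under eq_cvg do rewrite /= expr2.
      exact: cvgM.
  apply: (le_trans (fatou _ measurableT mf f0)); apply: limn_einf_le_cst => j.
  have lus := Lfun2B (lu n) (lu (s (j + k)%N)).
  rewrite -[leLHS]fineK; last first.
    by apply: integrable_fin_num => //; exact: Lfun2_integrable_sqr lus.
  rewrite lee_fin; have := hN k n (s (j + k)%N) kn (sN _ _ (leq_addl _ _)).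
  by congr (_ <= _); apply: eq_Rintegral => x _; rewrite expr2.
have lh : L2 h.
  have lsub : L2 (u (N 0%N) - h).
    apply/Lfun2P; split; first exact: measurable_funB.
    apply/integrableP; split.
      by apply/measurable_EFinP; apply: measurable_funX; exact: measurable_funB.
    under eq_integral do rewrite gee0_abs ?lee_fin ?sqr_ge0//.
    by apply: le_lt_trans (bound 0%N (N 0%N) (leqnn _)) _; rewrite ltry.
  by rewrite -[h](subKr (u (N 0%N))) Lfun2B.
exists h => // e e0.
have [k ke] : exists k, (4^-1) ^+ k <= e :> R.
  have /cvgrPdist_le/(_ _ e0)[k _ hk] : (4^-1 : R) ^+ k @[k --> \oo] --> 0.
    by apply: cvg_expr; rewrite gtr0_norm// invf_lt1// ltr1n.
  by exists k; have := hk k (leqnn k); rewrite sub0r normrN ger0_norm// ltW.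
exists (N k) => n /bound bn; apply: le_trans ke.
rewrite -lee_fin; apply: le_trans bn.
rewrite /dot /Rintegral fineK.
  by under eq_integral do rewrite -expr2.
have lunh := Lfun2B (lu n) lh.
by apply: integrable_fin_num => //; exact: (Lfun2_mul_integrable lunh lunh).
Qed.
End riesz_fischer.

(** * Parseval's inequality and relative compactness for total orthonormal systems padded with null
    functions *)

Section hilbert.
Context d (T : measurableType d) (R : realType).
Variable mu : {finite_measure set T -> \bar R}.
Local Notation L2 f := (f \in Lfun mu 2%:E).
Local Notation dot := (dot mu).
Variable e : nat -> T -> R.
Hypotheses (le : forall i, L2 (e i))
  (eo : forall i j, i != j -> dot (e i) (e j) = 0)
  (e01 : forall i, dot (e i) (e i) = 1 \/ e i = 0)
  (e_total : forall h, L2 h -> (forall i, dot (e i) h = 0) -> dot h h = 0).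

Let p v n : T -> R := \sum_(i < n) dot (e i) v *: e i.

Let lp v n : L2 (p v n).
Proof.
apply: (@Lfun2_sum _ _ _ _ n (fun i => dot (e i) v *: e i)) => i.
exact: Lfun2Z.
Qed.

Let pE v n w : L2 w -> dot (p v n) w = \sum_(i < n) dot (e i) v * dot (e i) w.
Proof. by move=> lw; exact: (@dot_suml _ _ _ _ n (fun i => dot (e i) v)). Qed.

Let coef v i : dot (e i) v * dot (e i) (e i) = dot (e i) v.
Proof. by have [->|->] := e01 i; rewrite ?mulr1// !dot0l mulr0. Qed.

Let p_coef v n i : dot (e i) (p v n) = if (i < n)%N then dot (e i) v else 0.
Proof.
rewrite dotC pE//; case: ifPn => [lt_in|nin].
  rewrite (bigD1 (Ordinal lt_in))//= coef big1 ?addr0// => j ji.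
  by rewrite eo ?mulr0//; apply: contraNneq ji => jE; apply/eqP/val_inj.
by rewrite big1// => j _; rewrite eo ?mulr0//; apply: contraNneq nin => <-.
Qed.

Let coef_le v i : L2 v -> dot (e i) v ^+ 2 <= dot v v.
Proof.
move=> lv; apply: le_trans (bessel i.+1 le eo _ lv).
  by rewrite big_ord_recr/= lerDr sumr_ge0// => j _; rewrite sqr_ge0.
by move=> j; have [->//|->] := e01 j; rewrite dot0l.
Qed.

(** The partial Fourier sums are Cauchy, hence converge to some [h] by Riesz-Fischer. The difference
    [v - h] has no Fourier coefficient, so it has norm zero by totality, and the square norms of the
    partial sums tend to that of [v]. *)
Lemma parseval_le v B : L2 v ->
  (forall n, \sum_(i < n) dot (e i) v ^+ 2 <= B) -> dot v v <= B.
Proof.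
move=> lv vB.
pose c n := \sum_(i < n) dot (e i) v ^+ 2.
have ndc : {homo c : m n / (m <= n)%N >-> m <= n}.
  by apply/nondecreasing_seqP => n; rewrite /c big_ord_recr/= lerDl sqr_ge0.
have cc : cvgn c.
  by apply: nondecreasing_is_cvgn => //; exists B => _ [n _ <-]; exact: vB.
have pp m n : (m <= n)%N -> dot (p v m) (p v n) = c m.
  move=> mn; rewrite pE//; apply: eq_bigr => i _.
  by rewrite p_coef (leq_trans (ltn_ord i) mn) expr2.
have dp m n : (m <= n)%N -> dot (p v m - p v n) (p v m - p v n) = c n - c m.
  by move=> mn; rewrite dot_subE// !pp//; ring.
have [//|h lh ph] := riesz_fischer (lp v).
  move=> eps e0; have /cvgrPdist_le/(_ _ (divr_gt0 e0 (ltr0Sn R 1)))[N _ hN] := cc.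
  exists N => m n Nm Nn; have := hN m Nm; have := hN n Nn.
  rewrite /= !ler_distl => /andP[? ?] /andP[? ?].
  have [mn|/ltnW mn] := leqP m n; first by rewrite dp//; lra.
  by rewrite dot_subC dp//; lra.
have vh : dot (v - h) (v - h) = 0.
  apply: e_total => [|i]; first exact: Lfun2B.
  apply/eqP; rewrite -sqrf_eq0 eq_le sqr_ge0 andbT; apply/ler_addgt0Pr => eps e0.
  rewrite add0r; have [N hN] := ph _ e0; pose n := maxn N i.+1.
  apply: le_trans (hN n (leq_maxl _ _)).
  (* For [i < n], [v] and its partial sum [p v n] have the same coefficient, and [p v n - h] is
     small in norm. *)
  rewrite (_ : dot (e i) (v - h) = dot (e i) (p v n - h)).
    by apply: coef_le; exact: Lfun2B.
  by rewrite !dotBr// p_coef (leq_maxr N i.+1).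
apply/ler_addgt0Pr => eps e0.
have [N hN] := ph _ (divr_gt0 e0 (ltr0Sn R 1)).
have := dot_sub_le lv lh (lp v N); rewrite vh (dot_subC _ h).
have := hN N (leqnn N); have := vB N; rewrite -/(c N) dot_subE// (dotC _ v).
rewrite (pE v N lv) (eq_bigr (fun i : 'I_N => dot (e i) v ^+ 2)) => [|i _].
  by rewrite -/(c N) pp//; lra.
by rewrite expr2.
Qed.

(* An ultrafilter on the indices makes all Fourier coefficients converge at
   once, which replaces a diagonal extraction. *)
Lemma compact_of_small_tails (g : nat -> T -> R) (B : R) :
  (forall n, L2 (g n)) -> (forall n, dot (g n) (g n) <= B) ->
  (forall eps, 0 < eps -> exists N, forall m n,
     \sum_(N <= i < m) dot (e i) (g n) ^+ 2 <= eps) ->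
  exists s h, [/\ {homo s : m n / (m < n)%N}, L2 h & forall eps, 0 < eps ->
    exists N, forall n, (N <= n)%N -> dot (g (s n) - h) (g (s n) - h) <= eps].
Proof.
move=> lg gB tails.
have B0 : 0 <= B by apply: le_trans (gB 0%N); exact: dot_ge0.
have [U [uU ooU]] := ultraFilterLemma eventually_filter.
have pU := @ultra_proper _ _ uU.
have aU i : exists l, forall eps, 0 < eps -> U [set n | `|dot (e i) (g n) - l| <= eps].
  pose a n := dot (e i) (g n).
  have aB n : - (B + 1) <= a n <= B + 1.
    have := le_trans (coef_le i (lg n)) (gB n); rewrite -/(a n) => a2.
    nra.
  have /(_ (fmap a U)) [] := @segment_compact R (- (B + 1)) (B + 1).
    apply: (@filterS _ U _ setT); last exact: filterT.
    by move=> n _ /=; rewrite in_itv/=; exact: (aB n).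
  move=> l [_ al]; exists l => eps e0.
  (* An ultrafilter converges to its cluster points: otherwise it would contain the complement of a
     neighbourhood of [l], which misses a ball around [l]. *)
  have [//|] := in_ultra_setVsetC [set n | `|a n - l| <= eps] uU.
  move=> nU; have := al (~` [set y | `|y - l| <= eps]) (ball l eps).
  case=> //; first exact: nbhsx_ballx.
  by move=> y [/= h]; rewrite /ball/= distrC => /ltW.
have cU k : exists2 A, U A & forall m n, A m -> A n ->
    dot (g m - g n) (g m - g n) <= (4^-1) ^+ k.
  set eps := _ ^+ _; have e0 : 0 < eps by rewrite exprn_gt0.
  (* Low modes and tail get [eps / 2] each. In the tail, the square of a difference is at most twice
     the sum of the squares, whence [4 * (eps / 8)]. In each of the [N] low modes two coefficients
     differ by at most [2 * delta], whose square is [eps / (2 * N.+1)]; the successor avoids a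
     division by zero. *)
  have [N hN] := tails (eps / 8) (divr_gt0 e0 (ltr0Sn R 7)).
  have /choice[l hl] := aU.
  have d0 : 0 < eps / (2 * N.+1%:R) by rewrite divr_gt0// mulr_gt0.
  pose delta := Num.sqrt (eps / (2 * N.+1%:R)) / 2.
  have delta0 : 0 < delta by rewrite divr_gt0// sqrtr_gt0.
  exists [set n | forall i : 'I_N, `|dot (e i) (g n) - l i| <= delta].
    by apply: filter_forall => i; exact: hl.
  move=> m n /= Am An; have lmn := Lfun2B (lg m) (lg n).
  apply: parseval_le => // M.
  have M1 : \sum_(i < M) dot (e i) (g m - g n) ^+ 2 <=
            \sum_(0 <= i < maxn M N) dot (e i) (g m - g n) ^+ 2.
    rewrite -(big_mkord xpredT (fun i => dot (e i) (g m - g n) ^+ 2)).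
    rewrite (@big_cat_nat _ _ _ M 0 (maxn M N))//= ?leq_maxl// lerDl.
    by apply: sumr_ge0 => i _; exact: sqr_ge0.
  apply: le_trans M1 _; rewrite (@big_cat_nat _ _ _ N)//= ?leq_maxr//.
  have S1 : \sum_(0 <= i < N) dot (e i) (g m - g n) ^+ 2 <= eps / 2.
    rewrite big_mkord; apply: (@le_trans _ _ (\sum_(i < N) eps / (2 * N.+1%:R))).
      apply: ler_sum => i _; rewrite dotBr//.
      have := Am i; have := An i; rewrite !ler_distl => /andP[? ?] /andP[? ?].
      have -> : eps / (2 * N.+1%:R) = (2 * delta) ^+ 2.
        rewrite (_ : 2 * delta = Num.sqrt (eps / (2 * N.+1%:R))) ?sqr_sqrtr ?ltW//.
        by rewrite /delta; field.
      rewrite -[leLHS]real_normK ?num_real// ler_sqr ?nnegrE//; last lra.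
      by rewrite ler_norml; lra.
    rewrite sumr_const card_ord.
    have -> : eps / (2 * N.+1%:R) *+ N = eps / 2 * (N%:R / N.+1%:R).
      by rewrite -mulr_natr invfM -!mulrA; congr (_ * (_ * _)); exact: mulrC.
    by rewrite ler_piMr ?divr_ge0 ?ltW// ltr_pdivrMr// mul1r ltr_nat.
  have S2 : \sum_(N <= i < maxn M N) dot (e i) (g m - g n) ^+ 2 <= eps / 2.
    apply: (@le_trans _ _ (2 * (\sum_(N <= i < maxn M N) dot (e i) (g m) ^+ 2) +
      2 * (\sum_(N <= i < maxn M N) dot (e i) (g n) ^+ 2))).
      rewrite !mulr_sumr -big_split/=; apply: ler_sum => i _; rewrite dotBr//.
      set a := dot _ _; set b := dot _ _; have := sqr_ge0 (a + b); nra.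
    by have := hN (maxn M N) m; have := hN (maxn M N) n; lra.
  lra.
have /choice[A hA] : forall k, exists A, U A /\ forall m n, A m -> A n ->
    dot (g m - g n) (g m - g n) <= (4^-1) ^+ k.
  by move=> k; have [A ? ?] := cU k; exists A.
have pick k N : exists n, (N < n)%N /\ forall j : 'I_k.+1, A j n.
  have : U ([set n | (N < n)%N] `&` [set n | forall j : 'I_k.+1, A j n]).
    apply: filterI; first by apply: ooU; exists N.+1.
    by apply: filter_forall => i; exact: (hA i).1.
  by move=> /filter_ex[n [? ?]]; exists n.
have /choice[f hf] : forall kN : nat * nat,
    exists n, (kN.2 < n)%N /\ forall j : 'I_kN.1.+1, A j n.
  by move=> [k N]; exact: pick.
pose s := fix s k := if k is k'.+1 then f (k, s k') else f (0%N, 0%N).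
have sA k j : (j <= k)%N -> A j (s k).
  move=> jk; have jk' : (j < k.+1)%N by [].
  by case: k jk jk' => [|k] jk jk' /=; [have := (hf (0%N, 0%N)).2 (Ordinal jk')|
     have := (hf (k.+1, s k)).2 (Ordinal jk')].
have sS k : (s k < s k.+1)%N by exact: (hf (k.+1, s k)).1.
have [||h lh sh] := @riesz_fischer _ _ _ mu (g \o s); first by move=> n; exact: lg.
  move=> eps e0.
  have [k ke] : exists k, (4^-1) ^+ k <= eps :> R.
    have /cvgrPdist_le/(_ _ e0)[k _ hk] : (4^-1 : R) ^+ k @[k --> \oo] --> 0.
      by apply: cvg_expr; rewrite gtr0_norm// invf_lt1// ltr1n.
    by exists k; have := hk k (leqnn k); rewrite sub0r normrN ger0_norm// ltW.
  exists k => m n km kn; apply: le_trans ke.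
  by apply: (hA k).2; exact: sA.
exists s, h; split => //; apply: homo_ltn => //; exact: ltn_trans.
Qed.
End hilbert.

(** * Tensor products on finite powers *)

Section cons_measure_integral.
Context d (T : measurableType d) (R : realType) (n : nat).
Variables (m1 : {finite_measure set T -> \bar R})
          (m2 : {finite_measure set (n.-tuple T) -> \bar R}).

Lemma ge0_integral_cons (f : n.+1.-tuple T -> \bar R) : measurable_fun setT f ->
  (forall t, 0 <= f t)%E ->
  (\int[cons_measure m1 m2]_t f t = \int[m1 \x m2]_p f (cons_pair p))%E.
Proof.
move=> mf f0; rewrite ge0_integral_pushforward//=.
exact: measurable_cons_pair.
Qed.

Lemma integrable_cons (f : n.+1.-tuple T -> \bar R) : measurable_fun setT f ->
  (m1 \x m2)%E.-integrable setT (f \o @cons_pair _ _ n) ->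
  (cons_measure m1 m2).-integrable setT f.
Proof.
move=> mf if_; apply: integrable_pushforward => //.
exact: measurable_cons_pair.
Qed.

Lemma integrable_consN (f : n.+1.-tuple T -> \bar R) :
  (cons_measure m1 m2).-integrable setT f ->
  (m1 \x m2)%E.-integrable setT (f \o @cons_pair _ _ n).
Proof.
move=> /integrableP[mf fy]; apply/integrableP; split.
  by apply: measurableT_comp => //; exact: measurable_cons_pair.
by rewrite ge0_integral_cons// in fy; exact: measurableT_comp.
Qed.

Lemma integral_cons (f : n.+1.-tuple T -> \bar R) :
  (cons_measure m1 m2).-integrable setT f ->
  (\int[cons_measure m1 m2]_t f t = \int[m1 \x m2]_p f (cons_pair p))%E.
Proof.
move=> if_; rewrite integral_pushforward//=.
- exact: measurable_cons_pair.
- exact: measurable_int if_.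
- exact: integrable_consN.
Qed.

End cons_measure_integral.

Section prod_fun.
Context d1 d2 (T1 : measurableType d1) (T2 : measurableType d2) (R : realType).
Variables (m1 : {finite_measure set T1 -> \bar R})
          (m2 : {finite_measure set T2 -> \bar R}) (f : T1 -> R) (g : T2 -> R).
Hypotheses (if_ : m1.-integrable setT (EFin \o f))
           (ig : m2.-integrable setT (EFin \o g)).

Let mf : measurable_fun setT f.
Proof. by apply/measurable_EFinP; exact: measurable_int if_. Qed.

Let mg : measurable_fun setT g.
Proof. by apply/measurable_EFinP; exact: measurable_int ig. Qed.

Let mfg : measurable_fun setT (fun p : T1 * T2 => f p.1 * g p.2).
Proof. by apply: measurable_funM; apply: measurableT_comp. Qed.

Lemma integrable_prod_fun :
  (m1 \x m2)%E.-integrable setT (EFin \o (fun p => f p.1 * g p.2)).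
Proof.
apply/integrable12ltyP; first exact/measurable_EFinP.
under eq_integral => x _.
  under eq_integral => y _ do rewrite /= normrM EFinM.
  rewrite ge0_integralZl//; last first.
    by apply/measurable_EFinP; exact: measurableT_comp.
  over.
rewrite ge0_integralZr//.
- case/integrableP: if_ => _ iy1; case/integrableP: ig => _ iy2.
  apply: lte_mul_pinfty => //; first exact: integral_ge0.
  by rewrite ge0_fin_numE//; exact: integral_ge0.
- by apply/measurable_EFinP; exact: measurableT_comp.
- exact: integral_ge0.
Qed.

Lemma Rintegral_prod_fun :
  \int[(m1 \x m2)%E]_p (f p.1 * g p.2) = \int[m1]_x f x * \int[m2]_y g y.
Proof.
rewrite /Rintegral -integral12_prod_meas1/=; last exact: integrable_prod_fun.
rewrite /fubini_F -fineM; [|exact: integrable_fin_num..].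
congr fine; under eq_integral => x _.
  under eq_integral => y _ do rewrite /= EFinM.
  rewrite integralZl//; over.
rewrite -{1}(@fineK _ (\int[m2]_y (g y)%:E)%E); last exact: integrable_fin_num.
by rewrite integralZr// fineK//; exact: integrable_fin_num.
Qed.
End prod_fun.

(** Integrability of every section, and not of almost every one, makes the inner integrals finite
    everywhere, so that taking their real values loses nothing. *)
Lemma Rintegral_Fubini d1 d2 (T1 : measurableType d1) (T2 : measurableType d2)
    (R : realType) (m1 : {finite_measure set T1 -> \bar R})
    (m2 : {finite_measure set T2 -> \bar R}) (k : T1 * T2 -> R) :
  (m1 \x m2)%E.-integrable setT (EFin \o k) ->
  (forall x, m2.-integrable setT (EFin \o (fun y => k (x, y)))) ->
  (forall y, m1.-integrable setT (EFin \o (fun x => k (x, y)))) ->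
  \int[m1]_x \int[m2]_y k (x, y) = \int[m2]_y \int[m1]_x k (x, y).
Proof.
move=> ik i1 i2; transitivity (fine (\int[m1]_x \int[m2]_y (k (x, y))%:E)%E).
  congr fine; apply: eq_integral => x _.
  exact: (fineK (integrable_fin_num measurableT (i1 x))).
transitivity (fine (\int[m2]_y \int[m1]_x (k (x, y))%:E)%E).
  by congr fine; exact: (Fubini ik).
congr fine; apply: eq_integral => y _; apply: esym.
exact: (fineK (integrable_fin_num measurableT (i2 y))).
Qed.

Definition tensor (T : Type) (R : pzSemiRingType) n (phi : 'I_n -> T -> R)
    (x : n.-tuple T) : R :=
  \prod_(k < n) phi k (tnth x k).

Section tensor.
Context d (T : measurableType d) (R : realType).
Implicit Types (n : nat).

Lemma tensor_cons n (phi : 'I_n.+1 -> T -> R) p :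
  tensor phi (cons_pair p) = phi ord0 p.1 * tensor (fun k => phi (lift ord0 k)) p.2.
Proof.
rewrite /tensor big_ord_recl tnth0; congr (_ * _).
by apply: eq_bigr => k _; rewrite tnthS.
Qed.

Lemma tensorM n (phi psi : 'I_n -> T -> R) x :
  tensor phi x * tensor psi x = tensor (fun k y => phi k y * psi k y) x.
Proof. by rewrite /tensor big_split. Qed.

Lemma measurable_tensor n (phi : 'I_n -> T -> R) :
  (forall k, measurable_fun setT (phi k)) -> measurable_fun setT (tensor phi).
Proof.
move=> mphi; apply: measurable_prod => k _.
by apply: measurableT_comp => //; exact: measurable_tnth.
Qed.

Lemma integrable_tensor n (m : 'I_n -> {finite_measure set T -> \bar R})
    (phi : 'I_n -> T -> R) :
  (forall k, (m k).-integrable setT (EFin \o phi k)) ->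
  (tuple_measure m).-integrable setT (EFin \o tensor phi) /\
  \int[tuple_measure m]_x tensor phi x = \prod_(k < n) \int[m k]_y phi k y.
Proof.
elim: n m phi => [|n ih] m phi iphi.
  split.
    apply: (eq_integrable _ (cst 1%:E)) => //.
      by move=> x _; rewrite /= /tensor big_ord0.
    exact: finite_measure_integrable_cst.
  rewrite /Rintegral/= integral_dirac//.
    by rewrite diracT mul1e/= /tensor !big_ord0.
  by apply/measurable_EFinP; apply: measurable_tensor; case.
have mphi k : measurable_fun setT (phi k).
  by apply/measurable_EFinP; exact: measurable_int (iphi k).
have [i2 e2] := ih (fun k => m (lift ord0 k)) _ (fun k => iphi (lift ord0 k)).
have ip := integrable_prod_fun (iphi ord0) i2.
have iT : (tuple_measure m).-integrable setT (EFin \o tensor phi).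
  apply: integrable_cons; first by apply/measurable_EFinP; exact: measurable_tensor.
  by apply: eq_integrable ip => // p _; rewrite /= tensor_cons.
split => //.
rewrite {1}/Rintegral/= integral_cons//=.
under eq_integral do rewrite tensor_cons.
by rewrite -[LHS]/(Rintegral _ _ _) Rintegral_prod_fun// e2 big_ord_recl.
Qed.

Lemma Lfun2_tensor n (m : 'I_n -> {finite_measure set T -> \bar R}) (phi : 'I_n -> T -> R) :
  (forall k, phi k \in Lfun (m k) 2%:E) -> tensor phi \in Lfun (tuple_measure m) 2%:E.
Proof.
move=> lphi; apply/Lfun2P; split.
  by apply: measurable_tensor => k; exact: Lfun2_measurable.
have [|it _] := @integrable_tensor n m (fun k y => phi k y ^+ 2).
  by move=> k; exact: Lfun2_integrable_sqr.
by apply: eq_integrable it => // x _; rewrite /= [in RHS]expr2 tensorM.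
Qed.

Lemma dot_tensor n (m : 'I_n -> {finite_measure set T -> \bar R})
    (phi psi : 'I_n -> T -> R) :
  (forall k, phi k \in Lfun (m k) 2%:E) -> (forall k, psi k \in Lfun (m k) 2%:E) ->
  dot (tuple_measure m) (tensor phi) (tensor psi) = \prod_(k < n) dot (m k) (phi k) (psi k).
Proof.
move=> lphi lpsi; have [|_ <-] := @integrable_tensor n m (fun k y => phi k y * psi k y).
  by move=> k; exact: Lfun2_mul_integrable.
by apply: eq_Rintegral => x _; rewrite tensorM.
Qed.

(** The cylinder over a null set of the [k]-th factor is null: its indicator is a tensor of an
    indicator and constants, whose integral is a product with a zero factor. *)
Lemma ae_tnth n (m : 'I_n -> {finite_measure set T -> \bar R}) (P : 'I_n -> set T) :
  (forall k, {ae m k, forall y, P k y}) ->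
  {ae tuple_measure m, forall x, forall k, P k (tnth x k)}.
Proof.
move=> aeP; apply: filter_forall => k.
have [N [mN N0 PN]] := aeP k.
have mkN : measurable ((fun x : n.-tuple T => tnth x k) @^-1` N).
  by rewrite -[X in measurable X]setTI; exact: measurable_tnth.
exists ((fun x => tnth x k) @^-1` N); split => //; last by move=> x /= nP; exact: PN.
pose phi j : T -> R := if j == k then \1_N else cst 1.
have iphi j : (m j).-integrable setT (EFin \o phi j).
  rewrite /phi; case: ifP => _; last exact: finite_measure_integrable_cst.
  exact: integrable_indic.
have [it et] := integrable_tensor iphi.
have E x : tensor phi x = \1_((fun x => tnth x k) @^-1` N) x.
  rewrite /tensor (bigD1 k)//= {1}/phi eqxx big1 ?mulr1// => j jk.
  by rewrite /phi (negbTE jk).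
have := et; under eq_Rintegral do rewrite E.
rewrite (bigD1 k)//= {1}/phi eqxx /Rintegral !integral_indic// !setIT.
rewrite [X in fine X * _]N0/= mul0r => /eqP; rewrite fine_eq0; first by move/eqP.
exact: fin_num_measure.
Qed.

End tensor.

(** * Totality of tensor products *)

Section cons_total.
Context d (T : measurableType d) (R : realType) (n : nat) (J : Type).
Variables (m1 : {finite_measure set T -> \bar R})
          (m2 : {finite_measure set (n.-tuple T) -> \bar R}).
Variables (e1 : nat -> T -> R) (e2 : J -> n.-tuple T -> R).
Hypotheses (le1 : forall i, e1 i \in Lfun m1 2%:E)
  (le2 : forall j, e2 j \in Lfun m2 2%:E)
  (total1 : forall h, h \in Lfun m1 2%:E ->
     (forall i, dot m1 (e1 i) h = 0) -> dot m1 h h = 0)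
  (total2 : forall h, h \in Lfun m2 2%:E ->
     (forall j, dot m2 (e2 j) h = 0) -> dot m2 h h = 0).
Variable h : n.+1.-tuple T -> R.
Variable e : nat -> J -> n.+1.-tuple T -> R.
Hypotheses (lh : h \in Lfun (cons_measure m1 m2) 2%:E)
  (me : forall i j, measurable_fun setT (e i j))
  (eE : forall i j p, e i j (cons_pair p) = e1 i p.1 * e2 j p.2)
  (h0 : forall i j, dot (cons_measure m1 m2) (e i j) h = 0).

Let H p := h (cons_pair p).

Let mH : measurable_fun setT H.
Proof.
by apply: measurableT_comp; [exact: Lfun2_measurable lh|exact: measurable_cons_pair].
Qed.

Let lH : H \in Lfun (m1 \x m2)%E 2%:E.
Proof.
apply/Lfun2P; split; first exact: mH.
exact: (integrable_consN (Lfun2_integrable_sqr lh)).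
Qed.

Let lprod (f : T -> R) (g : n.-tuple T -> R) : f \in Lfun m1 2%:E ->
  g \in Lfun m2 2%:E -> (fun p => f p.1 * g p.2) \in Lfun (m1 \x m2)%E 2%:E.
Proof.
move=> lf lg; apply/Lfun2P; split.
  apply: measurable_funM; apply: measurableT_comp => //.
    exact: Lfun2_measurable lf.
  exact: Lfun2_measurable lg.
have := integrable_prod_fun (Lfun2_integrable_sqr lf) (Lfun2_integrable_sqr lg).
by apply: eq_integrable => // p _ /=; rewrite exprMn.
Qed.

Let lsec : {ae m2, forall t, (fun x => H (x, t)) \in Lfun m1 2%:E}.
Proof.
have := ae_integrable2 (Lfun2_integrable_sqr lH); apply: filterS => t it.
apply/Lfun2P; split => //; apply: (measurableT_comp mH).
exact: measurable_pair2.
Qed.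

Let ieH i : (m1 \x m2)%E.-integrable setT (EFin \o (fun p => e1 i p.1 * H p)).
Proof.
have := Lfun2_mul_integrable (lprod (le1 i) (Lfun2_cst m2 1)) lH.
by apply: eq_integrable => // p _ /=; rewrite mulr1.
Qed.

Let G i t := dot m1 (e1 i) (fun x => H (x, t)).

Let mG i : measurable_fun setT (G i).
Proof.
apply: (measurableT_comp (@fine_measurable R setT measurableT)).
exact: (measurable_fubini_G (ieH i)).
Qed.

(** By Cauchy-Schwarz on each slice, [G i t ^+ 2] is at most [K t], and [K] is integrable by Fubini
    because [H] is in L^2. *)
Let lG i : G i \in Lfun m2 2%:E.
Proof.
apply/Lfun2P; split => //; apply/integrableP; split.
  by apply/measurable_EFinP; exact: measurable_funX.
pose K t := ((dot m1 (e1 i) (e1 i))%:E * \int[m1]_x ((H (x, t)) ^+ 2)%:E)%E.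
have iK : m2.-integrable setT K.
  have iH2 := Lfun2_integrable_sqr lH.
  suff iG : m2.-integrable setT (fubini_G m1 (EFin \o (fun p => H p ^+ 2))).
    exact: (integrableZl measurableT _ iG).
  apply/integrableP; split; first exact: (measurable_fubini_G iH2).
  under eq_integral => t _.
    rewrite gee0_abs; last by apply: integral_ge0 => x _; rewrite lee_fin sqr_ge0.
    over.
  rewrite (integral21_prod_meas1 iH2); exact: (integrable_lty measurableT iH2).
case/integrableP : (iK) => mK; apply: le_lt_trans.
apply: ae_ge0_le_integral => //.
- by apply: measurableT_comp => //; apply/measurable_EFinP; exact: measurable_funX.
- exact: measurableT_comp.
apply: filterS lsec => t lt _.
rewrite [leLHS]gee0_abs ?lee_fin ?sqr_ge0//; apply: le_trans (lee_abs _).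
rewrite /K -[(\int[_]_x _)%E]fineK.
  rewrite -EFinM lee_fin; apply: le_trans (dot_sqr_le (le1 i) lt) _.
  rewrite le_eqVlt; apply/orP; left; apply/eqP.
  by congr (_ * _); apply: eq_Rintegral => x _; rewrite expr2.
by apply: integrable_fin_num => //; exact: (Lfun2_integrable_sqr lt).
Qed.

Let G0 i : {ae m2, forall t, G i t = 0}.
Proof.
apply: dot_eq0_ae => //; apply: total2 => // j.
have ief : (m1 \x m2)%E.-integrable setT (EFin \o (fun p => e1 i p.1 * e2 j p.2 * H p)).
  exact: (Lfun2_mul_integrable (lprod (le1 i) (le2 j)) lH).
have <- := h0 i j.
rewrite /dot /Rintegral integral_cons; last first.
  apply: integrable_cons => /=.
    by apply/measurable_EFinP; apply: measurable_funM => //; exact: Lfun2_measurable lh.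
  by apply: eq_integrable ief => // p _; rewrite /= eE.
under [in RHS]eq_integral do rewrite eE.
congr fine; rewrite -(integral21_prod_meas1 ief).
apply: ae_eq_integral => //.
- by apply/measurable_EFinP; apply: measurable_funM => //; exact: Lfun2_measurable.
- exact: (measurable_fubini_G ief).
apply: filterS lsec => t lt _; rewrite /fubini_G/= /G /dot.
under eq_integral do rewrite mulrAC (mulrC (e1 i _ * _)) EFinM.
have it := Lfun2_mul_integrable (le1 i) lt.
by rewrite integralZl// EFinM [in LHS]fineK//; exact: integrable_fin_num.
Qed.

(** Each partial coefficient [G i] is orthogonal to all [e2 j], hence null almost everywhere. As [i]
    ranges over a countable set, almost every slice of [h] is orthogonal to all [e1 i] at once, so
    it has norm zero. *)
Lemma cons_total : dot (cons_measure m1 m2) h h = 0.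
Proof.
have G0' := ae_foralln G0.
have mH2 : measurable_fun setT (EFin \o (fun p => H p ^+ 2)).
  by apply/measurable_EFinP; exact: measurable_funX.
rewrite /dot /Rintegral; under eq_integral do rewrite -expr2.
rewrite integral_cons; last exact: Lfun2_integrable_sqr lh.
rewrite -(integral21_prod_meas1 (Lfun2_integrable_sqr lH)).
rewrite (ae_eq_integral (cst 0%E))//; first by rewrite integral0.
- exact: (measurable_fubini_G (Lfun2_integrable_sqr lH)).
apply: filterS2 G0' lsec => t Gt lt _ /=; rewrite /fubini_G.
have t0 := total1 lt (fun i => Gt i).
have i2 := Lfun2_integrable_sqr lt.
rewrite -[LHS]fineK; last exact: integrable_fin_num.
by congr (_%:E); rewrite -[RHS]t0; apply: eq_Rintegral => x _; rewrite expr2.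
Qed.

End cons_total.

Lemma tensor_total d (T : measurableType d) (R : realType) n
    (m : 'I_n -> {finite_measure set T -> \bar R}) (e : 'I_n -> nat -> T -> R) :
  (forall k i, e k i \in Lfun (m k) 2%:E) ->
  (forall k h, h \in Lfun (m k) 2%:E -> (forall i, dot (m k) (e k i) h = 0) ->
    dot (m k) h h = 0) ->
  forall h, h \in Lfun (tuple_measure m) 2%:E ->
  (forall a : 'I_n -> nat, dot (tuple_measure m) (tensor (fun k => e k (a k))) h = 0) ->
  dot (tuple_measure m) h h = 0.
Proof.
elim: n m e => [|n ih] m e le total h lh h0.
  (* On 0-tuples the measure is a Dirac mass and the empty tensor is 1, so the hypothesis says that
     [h] vanishes at the empty tuple. *)
  have := h0 (fun=> 0%N); rewrite /dot /Rintegral/= !integral_dirac//.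
  - by rewrite diracT !mul1e/= /tensor big_ord0 mul1r => ->; rewrite mul0r.
  - by apply/measurable_EFinP; apply: measurable_funM; exact: Lfun2_measurable lh.
  - apply/measurable_EFinP; apply: measurable_funM; last exact: Lfun2_measurable lh.
    by apply: measurable_tensor; case.
pose b i (a : 'I_n -> nat) k := if unlift ord0 k is Some k' then a k' else i.
apply: (@cons_total _ T R n ('I_n -> nat) (m ord0)
  (tuple_measure (fun k => m (lift ord0 k))) (e ord0)
  (fun a => tensor (fun k => e (lift ord0 k) (a k))) _ _ _ _ _
  (fun i a => tensor (fun k => e k (b i a k)))) => //.
- move=> a; exact: (@Lfun2_tensor _ _ _ n (fun k => m (lift ord0 k))
    (fun k => e (lift ord0 k) (a k)) (fun k => le (lift ord0 k) (a k))).
- exact: total.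
- move=> g lg; apply: (ih (fun k => m (lift ord0 k)) (fun k => e (lift ord0 k))) => //.
  by move=> k; exact: total.
- by move=> i a; apply: measurable_tensor => k; exact: Lfun2_measurable (le k _).
move=> i a p; rewrite tensor_cons /b unlift_none; congr (_ * _).
by apply: eq_bigr => k _; rewrite liftK.
Qed.

(** * Integrals of functions not known to be measurable *)

Section ae_eq_Rintegral.
Context d (T : measurableType d) (R : realType) (mu : {measure set T -> \bar R}).
Import HBNNSimple.

(** The integral is a supremum over the simple functions below the integrand. Setting such a
    function to 0 on the exceptional null set keeps its integral and brings it below [g]. *)
Lemma ge0_ae_le_integralT (f g : T -> \bar R) :
  (forall x, 0 <= f x)%E -> (forall x, 0 <= g x)%E ->
  {ae mu, forall x, (f x <= g x)%E} -> (\int[mu]_x f x <= \int[mu]_x g x)%E.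
Proof.
move=> f0 g0 [N [mN N0 fgN]]; rewrite !ge0_integralTE//.
apply: ge_ereal_sup => _ [h /= hf <-].
have mNc : measurable (~` N) by exact: measurableC.
apply: ereal_sup_ubound; exists (proj_nnsfun h mNc).
  move=> x; rewrite /= mindicE; have [xN|xN] := pselect (N x).
    by rewrite memNset ?mulr0//= => /(_ xN).
  rewrite mem_set// mulr1; apply: le_trans (hf x) _.
  by apply: contrapT => fg; apply: xN; apply: fgN.
rewrite -!integralT_nnsfun; apply: ge0_ae_eq_integral => //.
- by apply/measurable_EFinP.
- by apply/measurable_EFinP.
- by move=> x _; rewrite lee_fin mulr_ge0.
- by move=> x _; rewrite lee_fin.
exists N; split => // x /= hx; apply: contrapT => xN; apply: hx => _.
by rewrite /= mindicE mem_set// mulr1.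
Qed.

(* [gderive] is only controlled almost everywhere, and nothing makes it
   measurable: [ae_eq_integral] does not apply to it. *)
Lemma ae_eq_Rintegral (f g : T -> R) : {ae mu, forall x, f x = g x} ->
  \int[mu]_x f x = \int[mu]_x g x.
Proof.
move=> fg; congr fine; rewrite integralE [RHS]integralE.
by congr (_ - _)%E; apply/eqP; rewrite eq_le; apply/andP; split;
  apply: ge0_ae_le_integralT => //; apply: filterS fg => x;
  rewrite ?funeposE ?funenegE => ->.
Qed.

End ae_eq_Rintegral.

(** * One-dimensional operators *)

Section dW.
Context (R : realType) (V : cumulative R R).
Local Notation mu := (lebesgue_stieltjes_measure V).
Implicit Types (f : R -> R) (a b x : R).

Lemma dW_unitC : dW V (~` `[0%R, 1%R[%classic) = 0%E.
Proof. by rewrite /dW/= /mfrestr /mrestr setICl measure0. Qed.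

Lemma dW_null (N : set (measurableTypeR R)) : measurable N -> mu N = 0%E -> dW V N = 0%E.
Proof.
move=> mN N0; rewrite /dW/= /mfrestr /mrestr; apply/eqP.
rewrite eq_le measure_ge0 andbT -[leRHS]N0; apply: le_measure; rewrite ?inE//.
by apply: measurableI => //; exact: measurable_itv.
Qed.

Lemma ae_dW_unit : {ae dW V, forall x, x \in `[0, 1[%classic}.
Proof.
exists (~` `[0%R, 1%R[%classic); split => //; first exact: measurableC.
  exact: dW_unitC.
by move=> x /= h1 h2; apply: h1; rewrite inE.
Qed.

Lemma Rintegral_dW f : \int[dW V]_x f x = \int[mu]_(x in `[0, 1[) f x.
Proof.
transitivity (\int[dW V]_x ((f \_ `[0, 1[) x)).
  apply: ae_eq_Rintegral; have := ae_dW_unit.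
  apply: filterS; first exact: (ae_filter_ringOfSetsType (dW V)).
  by move=> x xu; rewrite patchE xu.
rewrite -Rintegral_mkcond; congr fine; apply: eq_measure_integral => A mA A01.
by rewrite /dW/= /mfrestr /mrestr setIidl.
Qed.

Lemma integral_dW (f : R -> \bar R) : measurable_fun setT f -> (forall x, 0 <= f x)%E ->
  (\int[dW V]_x f x = \int[mu]_(x in `[0%R, 1%R[) f x)%E.
Proof.
move=> mf f0; transitivity (\int[dW V]_x ((f \_ `[0%R, 1%R[) x))%E.
  apply: ae_eq_integral => //.
    by apply/(measurable_restrictT _ _).1 => //; exact: measurable_funTS.
  have := ae_dW_unit; apply: filterS; first exact: (ae_filter_ringOfSetsType (dW V)).
  by move=> x xu _; rewrite patchE xu.
rewrite -integral_mkcond; apply: eq_measure_integral => A mA A01.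
by rewrite /dW/= /mfrestr /mrestr setIidl.
Qed.

Lemma integrable_dW f : (dW V).-integrable setT (EFin \o f) <->
  measurable_fun setT f /\ mu.-integrable `[0, 1[ (EFin \o f).
Proof.
split=> [/integrableP[mf fy]|[mf /integrableP[_ fy]]].
  split; first exact/measurable_EFinP.
  apply/integrableP; split; first exact: measurable_funTS.
  by rewrite -integral_dW//; exact: measurableT_comp.
apply/integrableP; split; first exact/measurable_EFinP.
by rewrite integral_dW//; apply: measurableT_comp => //; exact/measurable_EFinP.
Qed.

Lemma dW_itv_oc a b : 0 <= a -> a <= b -> b < 1 -> dW V `]a, b]%classic = (V b - V a)%:E.
Proof.
move=> a0 ab b1; rewrite /dW/= /mfrestr /mrestr setIidl; last first.
  move=> x /=; rewrite !in_itv/= => /andP[ax xb].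
  by rewrite (le_trans a0 (ltW ax)) (le_lt_trans xb b1).
rewrite /lebesgue_stieltjes_measure /measure_extension/=.
by rewrite measurable_mu_extE/=; [rewrite wlength_itv_bnd|exact: is_ocitv].
Qed.

Lemma lsm_itv_oc a b : a <= b -> mu `]a, b]%classic = (V b - V a)%:E.
Proof.
move=> ab; rewrite /lebesgue_stieltjes_measure /measure_extension/=.
by rewrite measurable_mu_extE/=; [rewrite wlength_itv_bnd|exact: is_ocitv].
Qed.

Lemma lsm_itv_oc_lty a b : (mu `]a, b]%classic < +oo)%E.
Proof.
have [ab|ba] := leP a b; first by rewrite lsm_itv_oc ?ltry.
by rewrite set_itv_ge ?measure0// bnd_simp -leNgt ltW.
Qed.

(** The atom at [x] is the jump of [V] there, since the intervals []x - 1 / (n + 1), x]] decrease to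
    the singleton. *)
Lemma lsm_set1_cvg x : (V x - V (x - n.+1%:R^-1))%:E @[n --> \oo] --> mu [set x].
Proof.
pose F n := `]x - n.+1%:R^-1, x]%classic : set (measurableTypeR R).
have FE : \bigcap_n F n = [set x].
  apply/seteqP; split=> [y Fy|y /= ->{y} n _]; last first.
    by rewrite /F/= in_itv/= lexx andbT ltrBlDr ltrDl invr_gt0.
  have := Fy 0%N I; rewrite /F/= in_itv/= => /andP[_ yx].
  apply/eqP; rewrite eq_le yx/=; apply/ler_addgt0Pr => e e0.
  have [n ne] : exists n, n.+1%:R^-1 < e.
    have /cvgrPdist_lt/(_ _ e0)[n _ /(_ n (leqnn n))] := @cvg_harmonic R.
    by rewrite sub0r normrN ger0_norm ?invr_ge0// => ?; exists n.
  have := Fy n I; rewrite /F/= in_itv/= => /andP[+ _].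
  by rewrite ltrBlDr => /ltW xy; rewrite (le_trans xy)// lerD2l ltW.
have mF n : mu (F n) = (V x - V (x - n.+1%:R^-1))%:E.
  by apply: lsm_itv_oc; rewrite gerBl invr_ge0.
rewrite -FE.
have -> : (fun n => (V x - V (x - n.+1%:R^-1))%:E) = mu \o F.
  by apply/funext => n; rewrite /= mF.
apply: nonincreasing_cvg_mu.
- by change (mu (F 0%N) < +oo)%E; rewrite mF ltry.
- by move=> n; exact: measurable_itv.
- by rewrite FE; exact: measurable_set1.
- move=> m n mn; apply/subsetPset => y; rewrite /F/= !in_itv/= => /andP[+ ->].
  rewrite andbT; apply: le_lt_trans.
  by rewrite lerD2l lerN2 lef_pV2 ?posrE// ler_nat.
Qed.

(** Periodic increments give equal jumps. This reconciles [dW], carried by [[0, 1[], with the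
    integrals over []0, 1]] in the definition of the operator. *)
Lemma lsm_set1_periodic : (forall u, V (u + 1) - V u = V 1 - V 0) ->
  mu [set 0] = mu [set 1].
Proof.
move=> VP; have c0 := @lsm_set1_cvg 0.
have E : (fun n => (V 0 - V (0 - n.+1%:R^-1))%:E) =
         (fun n => (V 1 - V (1 - n.+1%:R^-1))%:E).
  apply/funext => n; congr (_%:E).
  by have := VP (- n.+1%:R^-1); rewrite (addrC _ 1) add0r; lra.
by rewrite E in c0; apply: (cvg_unique (@ereal_hausdorff R) c0); exact: lsm_set1_cvg.
Qed.

Lemma Rintegral_lsm_set1 f x : \int[mu]_(y in [set x]) f y = f x * fine (mu [set x]).
Proof.
rewrite -Rintegral_cst//; apply: eq_Rintegral => y.
by rewrite inE/= => ->.
Qed.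
End dW.

(** * Fluxes of elements of the domain *)

Section flux.
Context (R : realType).
Local Notation leb := (@lebesgue_measure R).
Implicit Types (V : cumulative R R) (f ff : R -> R) (b : R).

(** The generalized derivative, with respect to [V], of the element of the domain given by [b] and
    [ff]. *)
Definition flux b ff x : R := b + \int[leb]_(z in `[0, x]) ff z.

Lemma Lfun2_dx_integrable ff : ff \in Lfun (dx R) 2%:E ->
  leb.-integrable `[0, 1] (EFin \o ff).
Proof.
move=> /Lfun2_integrable /integrable_dW[mff /integrableP[_ fy]].
have mff' := measurableT_comp (@EFin_measurable _ _) mff.
apply/integrableP; split; first exact: measurable_funTS.
rewrite -integral_itv_bndo_bndc//.
by apply: measurable_funTS; exact: measurableT_comp.
Qed.

Section fixed.
Variables (ff : R -> R) (b : R).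
Hypothesis (lff : ff \in Lfun (dx R) 2%:E).

Let iff := Lfun2_dx_integrable lff.

Lemma flux0 : flux b ff 0 = b.
Proof. by rewrite /flux set_itv1 Rintegral_set1 addr0. Qed.

Lemma flux_continuous : {within `[0, 1], continuous (flux b ff)}.
Proof.
have c := parameterized_integral_continuous ler01 iff.
by move=> x; apply: cvgD; [exact: cvg_cst|exact: c].
Qed.

Lemma flux_near x e : 0 <= x <= 1 -> 0 < e -> exists2 r, 0 < r &
  forall y, 0 <= y <= 1 -> `|y - x| < r -> `|flux b ff y - flux b ff x| <= e.
Proof.
move=> x01 e0; have /subspace_continuousP/(_ x) := flux_continuous.
rewrite /= in_itv/= => /(_ x01)/cvgrPdist_le/(_ _ e0).
move=> [r /= r0 h]; exists r => // y y01 yx; rewrite distrC; apply: h => //=.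
by rewrite /ball/= distrC.
Qed.

Lemma flux_bounded : exists M, forall x, 0 <= x <= 1 -> `|flux b ff x| <= M.
Proof.
exists (`|b| + \int[leb]_(z in `[0, 1]) `|ff z|) => x /andP[x0 x1].
rewrite (le_trans (ler_normD _ _))// lerD2l.
have sub : `[0, x] `<=` `[0, 1] by apply: subset_itvl; rewrite bnd_simp.
have ix : leb.-integrable `[0, x] (EFin \o ff) by exact: integrableS iff.
apply: le_trans (le_normr_Rintegral _ ix) _ => //.
rewrite /Rintegral fine_le//.
- by apply: integrable_fin_num => //; exact: (integrable_abse ix).
- by apply: integrable_fin_num => //; exact: (integrable_abse iff).
apply: ge0_subset_integral => //.
by apply/measurable_EFinP; apply: measurableT_comp => //; apply/measurable_EFinP;
  exact: measurable_int iff.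
Qed.

Lemma flux_measurable (A : set R) : measurable A -> A `<=` `[0, 1] ->
  measurable_fun A (flux b ff).
Proof.
move=> mA A01; apply: (measurable_funS _ A01) => //.
apply: subspace_continuous_measurable_fun => //; exact: flux_continuous.
Qed.

Lemma flux_integrable V (A : set R) : measurable A -> A `<=` `[0, 1] ->
  (lebesgue_stieltjes_measure V A < +oo)%E ->
  (lebesgue_stieltjes_measure V).-integrable A (EFin \o flux b ff).
Proof.
move=> mA A01 Ay; apply: measurable_bounded_integrable => //.
  exact: flux_measurable.
have [M hM] := flux_bounded; exists M; split; first exact: num_real.
move=> m Mm x Ax; apply: le_trans (ltW Mm); apply: hM.
by have := A01 _ Ax; rewrite /= in_itv.
Qed.

(** The hypotheses control [ff], hence the flux, on the unit interval only, whereas membership in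
    [Lfun (dW V)] asks for measurability on the whole line. *)
Definition cut_flux := flux b ff \_ `[0, 1[.

Lemma cut_fluxE x : 0 <= x < 1 -> cut_flux x = flux b ff x.
Proof. by move=> x01; rewrite /cut_flux patchE mem_set//= in_itv. Qed.

Lemma Lfun2_cut_flux V : cut_flux \in Lfun (dW V) 2%:E.
Proof.
have mc : measurable_fun setT cut_flux.
  apply/(measurable_restrictT _ _).1 => //; apply: flux_measurable => //.
  by apply: subset_itvl; rewrite bnd_simp.
apply/Lfun2P; split => //; apply: measurable_bounded_integrable => //.
- by rewrite ltey_eq fin_num_measure.
- exact: measurable_funX.
have [M hM] := flux_bounded.
have M0 : 0 <= M by apply: le_trans (hM 0 _); rewrite ?lexx ?ler01.
exists (M ^+ 2); split; first exact: num_real.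
move=> m Mm x _; apply: le_trans (ltW Mm); rewrite normrX ler_sqr ?nnegrE//.
rewrite /cut_flux patchE; case: ifPn => [|_]; last by rewrite normr0.
by rewrite inE/= in_itv/= => /andP[x0 /ltW x1]; apply: hM; rewrite x0.
Qed.

End fixed.

(** The graph [opLW] with [b] exposed: [b * V x] and the iterated integral merge into one integral
    of the flux, and the remaining constant [a + b * V 0] is [f 0]. *)
Definition operator_flux V f ff b :=
  [/\ f \in Lfun (dx R) 2%:E /\ ff \in Lfun (dx R) 2%:E,
      forall x, f (x + 1) = f x,
      \int[leb]_(z in `[0, 1]) ff z = 0,
      \int[lebesgue_stieltjes_measure V]_(y in `]0, 1]) flux b ff y = 0 &
      forall x, 0 <= x < 1 ->
        f x = f 0 + \int[lebesgue_stieltjes_measure V]_(y in `]0, x]) flux b ff y].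

Lemma operator_flux_Lfun V f ff b : operator_flux V f ff b ->
  f \in Lfun (dx R) 2%:E /\ ff \in Lfun (dx R) 2%:E.
Proof. by case. Qed.

Lemma operator_flux_mean V f ff b : operator_flux V f ff b ->
  \int[leb]_(z in `[0, 1]) ff z = 0.
Proof. by case. Qed.

Lemma operator_flux_closed V f ff b : operator_flux V f ff b ->
  \int[lebesgue_stieltjes_measure V]_(y in `]0, 1]) flux b ff y = 0.
Proof. by case. Qed.

Lemma operator_flux_primitive V f ff b : operator_flux V f ff b ->
  forall x, 0 <= x < 1 ->
    f x = f 0 + \int[lebesgue_stieltjes_measure V]_(y in `]0, x]) flux b ff y.
Proof. by case. Qed.

Lemma opLW_operator_flux V f ff : opLW V f ff -> exists b, operator_flux V f ff b.
Proof.
move=> [lf lff pf ff0 [a [b [b0 fE]]]]; exists b; split => // x x01.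
have /andP[x0 /ltW x1] := x01.
have oc0 : `]0, 0]%classic = set0 :> set R by rewrite set_itv_ge// bnd_simp ltxx.
rewrite (fE 0) ?lexx ?ltr01// (fE x x01) oc0 Rintegral_set0 addr0 /flux.
have mx : (lebesgue_stieltjes_measure V `]0%R, x]%classic < +oo)%E.
  by rewrite lsm_itv_oc ?ltry.
have x01' : `]0, x]%classic `<=` `[0, 1]%classic.
  by move=> y /=; rewrite !in_itv/= => /andP[/ltW -> /le_trans ->].
rewrite RintegralD//; last 2 first.
- apply/integrableP; split; first exact: measurable_cst.
  by rewrite /= integral_cst//= lte_mul_pinfty.
- have := flux_integrable 0 lff (measurable_itv _) x01' mx.
  by apply: eq_integrable => // y _; rewrite /= /flux add0r.
rewrite Rintegral_cst//.
have E : fine (lebesgue_stieltjes_measure V `]0%R, x]%classic) = V x - V 0.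
  by rewrite lsm_itv_oc.
by rewrite [X in _ + (b * X + _)]E; ring.
Qed.
End flux.

(** * The generalized derivative of an element of the domain *)

Section operator.
Context (R : realType) (V : cumulative R R).
Hypotheses (V_incr : {homo V : x y / x < y})
  (V_periodic : forall u, V (u + 1) - V u = V 1 - V 0).
Local Notation mu := (lebesgue_stieltjes_measure V).
Variables (f ff : R -> R) (b : R).
Hypothesis fH : operator_flux V f ff b.
Local Notation F := (flux b ff).

Let lff : ff \in Lfun (dx R) 2%:E. Proof. by case: fH => -[]. Qed.

Let f1 : f 1 = f 0.
Proof. by case: fH => _ + _ _ _ => /(_ 0); rewrite add0r. Qed.

Let F1 : F 1 = b.
Proof. by case: fH => _ _ ff0 _ _; rewrite /flux ff0 addr0. Qed.

Let iF x y : 0 <= x -> x <= y -> y <= 1 -> mu.-integrable `]x, y] (EFin \o F).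
Proof.
move=> x0 xy y1; apply: flux_integrable => //; last by rewrite lsm_itv_oc ?ltry.
move=> z /=; rewrite !in_itv/= => /andP[xz zy].
by rewrite (le_trans x0 (ltW xz)) (le_trans zy y1).
Qed.

Lemma operator_flux_incr x y : 0 <= x -> x <= y -> y <= 1 ->
  f y - f x = \int[mu]_(z in `]x, y]) F z.
Proof.
have fE t : 0 <= t <= 1 -> f t = f 0 + \int[mu]_(y in `]0, t]) F y.
  (* The primitive formula extends to [t = 1]: there the integral of the flux vanishes, in agreement
     with [f 1 = f 0]. *)
  case: fH => _ _ _ F0 fE /andP[t0]; rewrite le_eqVlt => /predU1P[->|t1].
    by rewrite f1 F0 addr0.
  by apply: fE; rewrite t0.
move=> x0 xy y1; rewrite (fE y) ?(le_trans x0 xy)// (fE x) ?x0 ?(le_trans xy y1)//.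
have U : `]0, y]%classic = `]0, x]%classic `|` `]x, y]%classic :> set R.
  by rewrite -itv_bndbnd_setU// bnd_simp.
rewrite U Rintegral_setU//; first by ring.
  by rewrite -U; apply: iF => //; exact: le_trans xy.
apply/disj_setPS => z /= []; rewrite !in_itv/= => /andP[_ zx] /andP[xz _].
by have := le_lt_trans zx xz; rewrite ltxx.
Qed.

(** The quotient is the mean of the flux over []x, y]] for the measure of [V]. Differentiability
    thus reduces to continuity of the flux, even where [V] jumps. *)
Lemma operator_flux_average x y c e : 0 <= x -> x < y -> y <= 1 ->
  (forall z, x < z <= y -> `|F z - c| <= e) ->
  `|(f y - f x) / (V y - V x) - c| <= e.
Proof.
move=> x0 xy y1 Fc; have V0 : 0 < V y - V x by rewrite subr_gt0 V_incr.
have mxy : fine (mu `]x, y]%classic) = V y - V x by rewrite lsm_itv_oc ?ltW.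
have ic k : mu.-integrable `]x, y] (EFin \o cst k).
  apply: measurable_bounded_integrable => //; last exact: bounded_cst.
  exact: lsm_itv_oc_lty.
have ixy := iF x0 (ltW xy) y1.
have cint k : \int[mu]_(z in `]x, y]) cst k z = k * (V y - V x).
  by rewrite Rintegral_cst//; congr (_ * _).
rewrite (operator_flux_incr x0 (ltW xy) y1).
have lo : (c - e) * (V y - V x) <= \int[mu]_(z in `]x, y]) F z.
  rewrite -cint; apply: le_Rintegral => // z; rewrite /= in_itv/= => zxy.
  by have := Fc z zxy; rewrite ler_distl => /andP[].
have hi : \int[mu]_(z in `]x, y]) F z <= (c + e) * (V y - V x).
  rewrite -cint; apply: le_Rintegral => // z; rewrite /= in_itv/= => zxy.
  by have := Fc z zxy; rewrite ler_distl => /andP[].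
by rewrite ler_distl ler_pdivlMr// ler_pdivrMr// lo hi.
Qed.

(** Right quotients average the flux over []x, x + h]], left ones over []x + h, x]]. Left quotients
    at 0 are moved by periodicity to left quotients at 1, where the flux has the same value [b]. *)
Lemma operator_flux_quotient x : 0 <= x < 1 ->
  (f (x + h) - f x) / (V (x + h) - V x) @[h --> 0^'] --> F x.
Proof.
move=> /andP[x0 x1]; apply/cvgrPdist_le => e e0.
have x01 : 0 <= x <= 1 by rewrite x0 ltW.
have one01 : 0 <= (1 : R) <= 1 by rewrite ler01 lexx.
have [r r0 hr] := @flux_near _ _ b lff x e x01 e0.
have [r1 r10 hr1] := @flux_near _ _ b lff 1 e one01 e0.
have hlt (s : R) : 0 < s -> \forall h \near 0^', `|h| < s.
  move=> s0; near=> t; rewrite -[t]subr0 distrC; near: t.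
  by apply: cvgr_dist_lt => //; exact: nbhs_dnbhs.
(* The value 1 is a placeholder: at [x = 0] negative increments are handled near 1, with the radius
   [r1]. *)
pose rx : R := if 0 < x then x else 1.
have rx0 : 0 < rx by rewrite /rx; case: ifP.
near=> h.
have h0 : h != 0 by near: h; exact: nbhs_dnbhs_neq.
have hr' : `|h| < r by near: h; exact: hlt.
have hr1' : `|h| < r1 by near: h; exact: hlt.
have h1x : `|h| < 1 - x by near: h; apply: hlt; rewrite subr_gt0.
have hrx : `|h| < rx by near: h; exact: hlt.
have h1 : `|h| < 1 by near: h; exact: hlt.
rewrite distrC; have [hp|hn|] := ltgtP 0 h; last by move=> /esym/eqP; rewrite (negbTE h0).
- rewrite gtr0_norm// in hr' h1x.
  apply: operator_flux_average => //; [by rewrite ltrDl|lra|] => z /andP[xz zy].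
  by apply: hr; [lra|rewrite ger0_norm; lra].
have [xp|xn] := ltP 0 x.
  have hx : `|h| < x by rewrite /rx xp in hrx.
  rewrite ltr0_norm// in hr' h1x hx.
  rewrite (_ : (f (x + h) - f x) / _ = (f x - f (x + h)) / (V x - V (x + h))).
    apply: operator_flux_average => //; [lra|lra|lra|] => z /andP[xz zy].
    by apply: hr; [lra|rewrite ler0_norm; lra].
  by rewrite -[LHS]divrNN !opprB.
have {x0 xn}x0 : x = 0 by apply/le_anti; rewrite xn.
subst x; rewrite add0r.
rewrite ltr0_norm// in hr1' h1.
have -> : (f h - f 0) / (V h - V 0) = (f 1 - f (h + 1)) / (V 1 - V (h + 1)).
  case: fH => _ fp _ _ _; rewrite fp f1 -[LHS]divrNN !opprB; congr (_ / _).
  by have := V_periodic h; lra.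
rewrite flux0// -F1.
apply: operator_flux_average => //; [lra|lra|] => z /andP[xz zy].
by apply: hr1; [lra|rewrite ler0_norm; lra].
Unshelve. all: by end_near. Qed.

End operator.

(** * Almost everywhere derivative of a flux *)

Section flux_derivative.
Context (R : realType).
Local Notation leb := (@lebesgue_measure R).

Lemma dW_itv_open : {ae dx R, forall x, 0 < x < 1}.
Proof.
have x0 : {ae dx R, forall x, x != 0}.
  have N0 : dx R [set 0] = 0%E.
    by apply: dW_null; [exact: measurable_set1|exact: lebesgue_measure_set1].
  exists [set 0]; split; [exact: measurable_set1|exact: N0|].
  by move=> x /= /negP; rewrite negbK => /eqP.
have := @ae_dW_unit R idfun.
apply: (filterS2 _ _ x0); first exact: (ae_filter_ringOfSetsType (dx R)).
by move=> x xn0; rewrite inE/= in_itv/= => /andP[x0' ->]; rewrite lt_neqAle eq_sym xn0 x0'.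
Qed.

(** The fundamental theorem of calculus applies at the Lebesgue points of [ff], which are almost all
    points; 0 is discarded so that both one-sided increments stay inside the interval. *)
Lemma flux_derivative (ff : R -> R) b : ff \in Lfun (dx R) 2%:E ->
  {ae dx R, forall x, (flux b ff (x + h) - flux b ff x) / h @[h --> 0^'] --> ff x}.
Proof.
move=> lff; have iff := Lfun2_dx_integrable lff.
pose g := ff \_ `[0, 1].
have ig : leb.-integrable setT (EFin \o g).
  by rewrite /g -restrict_EFin; apply/integrable_restrict => //=; rewrite setTI.
have /lebesgue_differentiation aeg :=
  @integrable_locally _ _ _ (measurable_itv `[0, 1]) iff.
have {}aeg : {ae dx R, forall x, lebesgue_pt g x}.
  have [N [mN N0 gN]] := aeg.
  by exists N; split => //; exact: dW_null.
have := dW_itv_open; apply: (filterS2 _ _ aeg).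
  exact: (ae_filter_ringOfSetsType (dx R)).
move=> x gx /andP[x0 x1].
have ig1 : leb.-integrable [set` Interval (BLeft 0) (BRight 1)] (EFin \o g).
  exact: integrableS ig.
have [] := @FTC1_lebesgue_pt _ g (BLeft 0) x 1 x1 ig1 _ gx => //.
set G := fun y : R => _.
move=> dG GE.
have gE : g x = ff x by rewrite /g patchE mem_set//= in_itv/= !ltW.
rewrite -gE -GE.
have : h^-1 *: (G (h *: 1 + x) - G x) @[h --> 0^'] --> derive1 G x.
  by rewrite derive1E; exact: dG.
apply: cvg_trans; apply: near_eq_cvg; near=> h.
have FG y : 0 <= y <= 1 -> flux b ff y = b + G y.
  move=> /andP[y0 y1]; rewrite /flux /G; congr (_ + _); apply: eq_Rintegral => z.
  rewrite inE/= in_itv/= => /andP[z0 zy].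
  by rewrite /g patchE mem_set//= in_itv/= z0 (le_trans zy).
have hx : `|h| < x.
  near: h; apply: dnbhs0_lt => //.
have h1x : `|h| < 1 - x by near: h; apply: dnbhs0_lt; rewrite subr_gt0.
rewrite !FG; [|lra|].
  by rewrite /GRing.scale/= mulr1 (addrC h x) mulrC; congr (_ * _); ring.
by move: hx h1x; rewrite !ltr_norml => /andP[? ?] /andP[? ?]; lra.
Unshelve. all: by end_near. Qed.
End flux_derivative.

(** * Integration by parts on the circle *)

Section integration_by_parts.
Context (R : realType) (V : cumulative R R).
Hypotheses (V_periodic : forall u, V (u + 1) - V u = V 1 - V 0).
Local Notation mu := (lebesgue_stieltjes_measure V).
Local Notation leb := (@lebesgue_measure R).

Section one.
Variables (f ff : R -> R) (b : R).
Hypothesis fH : operator_flux V f ff b.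

Let lff : ff \in Lfun (dx R) 2%:E. Proof. by have [] := operator_flux_Lfun fH. Qed.

Lemma Rintegral_cut_flux (A : set R) : measurable A -> A `<=` `[0, 1[ ->
  dot (dW V) (\1_A) (cut_flux ff b) = \int[mu]_(x in A) flux b ff x.
Proof.
move=> mA A01; rewrite /dot Rintegral_dW -[in RHS](setIidr A01) Rintegral_mkcondr.
apply: eq_Rintegral => x x01; rewrite indicE patchE /cut_flux patchE x01.
by case: ifP; rewrite (mul1r, mul0r).
Qed.

(** As inner products with the flux, increments of [f] come within reach of Cauchy-Schwarz and
    Bessel in [L^2(dW)]. *)
Lemma operator_flux_eval x : 0 <= x < 1 ->
  f x = f 0 + dot (dW V) (\1_(`]0, x])) (cut_flux ff b).
Proof.
move=> x01; rewrite Rintegral_cut_flux//; first exact: (operator_flux_primitive fH x01).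
move=> y /=; rewrite !in_itv/= => /andP[/ltW -> yx].
by case/andP: x01 => _; exact: le_lt_trans.
Qed.

(* The atoms of [dW V] at 0 and 1 have the same mass, so the integral over
   [0, 1[ is the one over ]0, 1]. *)
Lemma flux_mean0 : \int[dW V]_x cut_flux ff b x = 0.
Proof.
transitivity (dot (dW V) (\1_(`[0, 1[)) (cut_flux ff b)).
  rewrite /dot; apply: eq_Rintegral => x _; rewrite indicE /cut_flux patchE.
  by case: ifP; rewrite (mul1r, mul0r).
rewrite Rintegral_cut_flux//.
have U0 : `[0, 1[%classic = [set 0] `|` `]0, 1[%classic :> set R.
  apply/seteqP; split=> x /=; rewrite !in_itv/=.
    by move=> /andP[]; rewrite le_eqVlt => /predU1P[<-|->] ?; [left|right].
  by case=> [->|/andP[/ltW -> ->]//]; rewrite lexx ltr01.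
have U1 : `]0, 1]%classic = `]0, 1[%classic `|` [set 1] :> set R.
  apply/seteqP; split=> x /=; rewrite !in_itv/=.
    by move=> /andP[-> ]; rewrite le_eqVlt => /predU1P[->|->]; [right|left].
  by case=> [/andP[-> /ltW ->]//|->]; rewrite lexx ltr01.
have mu01 : (mu `[0%R, 1%R]%classic < +oo)%E.
  apply: (@le_lt_trans _ _ (mu `](- 1)%R, 1%R]%classic)); last exact: lsm_itv_oc_lty.
  apply: le_measure; rewrite ?inE; [exact: measurable_itv|exact: measurable_itv|].
  move=> x /=; rewrite !in_itv/= => /andP[x0 ->].
  by rewrite andbT (lt_le_trans _ x0)// ltrN10.
have iF : mu.-integrable `[0, 1] (EFin \o flux b ff) by exact: flux_integrable.
have s0 : `[0, 1[%classic `<=` (`[0, 1]%classic : set R).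
  by apply: subset_itvl; rewrite bnd_simp.
have s1 : `]0, 1]%classic `<=` (`[0, 1]%classic : set R).
  by apply: subset_itvr; rewrite bnd_simp.
rewrite U0 Rintegral_setU//; last 2 first.
- by rewrite -U0; exact: integrableS iF.
- by apply/disj_setPS => x /= [->]; rewrite in_itv/= ltxx.
rewrite Rintegral_lsm_set1 flux0 (lsm_set1_periodic V_periodic).
have := operator_flux_closed fH; rewrite U1 Rintegral_setU//; last 2 first.
- by rewrite -U1; exact: integrableS iF.
- by apply/disj_setPS => x /= [/[swap] ->]; rewrite in_itv/= ltxx andbF.
by rewrite Rintegral_lsm_set1 {2}/flux (operator_flux_mean fH) addr0; lra.
Qed.

End one.

(** Fubini for [gg z * D y] on the triangle [z < y]: integrating in [y] first produces [- f z] up to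
    a constant, integrating in [z] first produces [G y - c]. The constants drop out because [gg] and
    [D] both have mean zero. *)
Lemma operator_flux_parts f ff b g gg c :
  operator_flux V f ff b -> operator_flux V g gg c ->
  dot (dW V) (cut_flux ff b) (cut_flux gg c) = - dot (dx R) f gg.
Proof.
move=> fH gH.
have [lf lff] := operator_flux_Lfun fH; have [lg lgg] := operator_flux_Lfun gH.
set D := cut_flux ff b; set G := cut_flux gg c.
have lD : D \in Lfun (dW V) 2%:E by exact: Lfun2_cut_flux.
have lG : G \in Lfun (dW V) 2%:E by exact: Lfun2_cut_flux.
have iD := Lfun2_integrable lD; have igg := Lfun2_integrable lgg.
have mlt : measurable [set p : measurableTypeR R * measurableTypeR R | p.1 < p.2].
  rewrite [X in measurable X](_ : _ =
      setT `&` (fun p : measurableTypeR R * measurableTypeR R =>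
                  (p.2 - p.1 : measurableTypeR R)) @^-1` `]0, +oo[).
    by apply: measurable_funB => //.
  by apply/seteqP; split=> [p|p [_]] /=; rewrite in_itv/= andbT subr_gt0.
pose k (p : measurableTypeR R * measurableTypeR R) : R :=
  gg p.1 * D p.2 * \1_[set p | p.1 < p.2] p.
have ik : (dx R \x dW V)%E.-integrable setT (EFin \o k).
  apply: le_integrable (integrable_prod_fun igg iD) => //.
    apply/measurable_EFinP; apply: measurable_funM; last exact: measurable_indic.
    by apply/measurable_EFinP; exact: measurable_int (integrable_prod_fun igg iD).
  move=> p _; rewrite lee_fin normrM ler_piMr// indicE.
  by case: (_ \in _); rewrite ?normr1 ?normr0.
have isec1 z : (dW V).-integrable setT (EFin \o (fun y => k (z, y))).
  apply: le_integrable (integrableZl measurableT (gg z) iD) => //.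
    apply: (measurableT_comp (measurable_int _ ik)); exact: measurable_pair1.
  move=> y _; change (`|k (z, y)|%:E <= `|gg z * D y|%:E)%E.
  rewrite lee_fin /k/= normrM ler_piMr// indicE.
  by case: (_ \in _); rewrite ?normr1 ?normr0.
have isec2 y : (dx R).-integrable setT (EFin \o (fun z => k (z, y))).
  apply: le_integrable (integrableZl measurableT (D y) igg) => //.
    apply: (measurableT_comp (measurable_int _ ik)); exact: measurable_pair2.
  move=> z _; change (`|k (z, y)|%:E <= `|D y * gg z|%:E)%E.
  rewrite lee_fin /k/= (mulrC (gg z)) normrM ler_piMr// indicE.
  by case: (_ \in _); rewrite ?normr1 ?normr0.
have m0 : measurable ([set 0] : set (measurableTypeR R)) by exact: measurable_set1.
(* The constant [C] disappears in the end because [gg] has mean zero. *)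
pose C := dot (dW V) (\1_[set 0]) D.
have inner1 z : 0 <= z < 1 -> \int[dW V]_y k (z, y) = gg z * (- C + f 0 - f z).
  (* On [[0, 1[] this is the indicator of []z, 1[], cut into pieces against which the integral of
     [D] is known: 0, [C] and [f z - f 0]. *)
  move=> z01; pose u : R -> R := cst 1 - \1_[set 0] - \1_`]0, z].
  have l0 : (\1_[set 0] : R -> R) \in Lfun (dW V) 2%:E by exact: Lfun2_indic.
  have lz : (\1_(`]0, z]) : R -> R) \in Lfun (dW V) 2%:E by exact: Lfun2_indic.
  have l1 := @Lfun2_cst _ _ _ (dW V) 1.
  have lu : u \in Lfun (dW V) 2%:E by apply: Lfun2B => //; exact: Lfun2B.
  transitivity (\int[dW V]_y (gg z * (u y * D y))).
    apply: ae_eq_Rintegral; have := @ae_dW_unit R V.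
    apply: filterS; first exact: (ae_filter_ringOfSetsType (dW V)).
    move=> y; rewrite inE/= in_itv/= => /andP[y0 y1]; rewrite /k/= -mulrA; congr (_ * _).
    rewrite mulrC; congr (_ * _).
    change (\1_[set p : R * R | p.1 < p.2] (z, y) = 1 - \1_[set 0] y - \1_`]0, z] y :> R).
    rewrite !indicE.
    have -> : ((z, y) \in [set p : R * R | p.1 < p.2]) = (z < y).
      by apply/idP/idP; rewrite inE.
    have -> : (y \in [set 0]) = (y == 0) by apply/idP/eqP; rewrite inE.
    have -> : (y \in `]0, z]%classic) = (0 < y <= z) by apply/idP/idP; rewrite inE/= in_itv.
    have [->|yn0] := eqVneq y 0.
      by case/andP: z01 => z0 _; rewrite ltxx (ltNge z) z0/=; ring.
    rewrite [0 < y]lt_neqAle eq_sym yn0 y0/= (leNgt y z); case: (z < y) => /=; ring.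
  rewrite RintegralZl//; last exact: Lfun2_mul_integrable.
  congr (_ * _); rewrite -[LHS]/(dot (dW V) u D) !dotBl// ?Lfun2B//.
  rewrite (operator_flux_eval fH z01) -/D.
  have -> : dot (dW V) (cst 1) D = 0.
    by rewrite -(flux_mean0 fH); apply: eq_Rintegral => y _; rewrite mul1r.
  by rewrite -/C; ring.
have inner2 y : 0 <= y < 1 -> \int[dx R]_z k (z, y) = D y * (G y - c).
  move=> y01; have /andP[y0 /ltW y1] := y01.
  have iggy : leb.-integrable `[0, y[ (EFin \o gg).
    apply: integrableS (Lfun2_dx_integrable lgg) => //.
    by apply: subset_itvl; rewrite bnd_simp.
  rewrite Rintegral_dW.
  transitivity (\int[leb]_(z in `[0, 1[) ((fun z => D y * gg z) \_ `[0, y[) z).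
    apply: eq_Rintegral => z; rewrite inE/= in_itv/= => /andP[z0 z1].
    rewrite patchE /k/= indicE.
    have -> : ((z, y) \in [set p : R * R | p.1 < p.2]) = (z < y).
      by apply/idP/idP; rewrite inE.
    have -> : (z \in `[0, y[%classic) = (z < y) by apply/idP/idP; rewrite inE/= in_itv/= z0.
    by case: ifP; rewrite ?mulr1 ?mulr0// mulrC.
  rewrite -Rintegral_mkcondr setIidr; last by apply: subset_itvl; rewrite bnd_simp.
  rewrite RintegralZl//; congr (_ * _).
  rewrite Rintegral_itv_bndo_bndc// /G cut_fluxE// /flux; ring.
have := Rintegral_Fubini ik isec1 isec2.
have -> : \int[dx R]_z \int[dW V]_y k (z, y) = \int[dx R]_z ((f 0 - C) * gg z - f z * gg z).
  apply: ae_eq_Rintegral; have := @ae_dW_unit R idfun.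
  apply: filterS; first exact: (ae_filter_ringOfSetsType (dx R)).
  by move=> z; rewrite inE/= in_itv/= => z01; rewrite inner1//; ring.
have -> : \int[dW V]_y \int[dx R]_z k (z, y) = \int[dW V]_y (D y * G y - c * D y).
  apply: ae_eq_Rintegral; have := @ae_dW_unit R V.
  apply: filterS; first exact: (ae_filter_ringOfSetsType (dW V)).
  by move=> z; rewrite inE/= in_itv/= => z01; rewrite inner2//; ring.
rewrite !RintegralB//; last 4 first.
- exact: Lfun2_mul_integrable.
- exact: (integrableZl measurableT c iD).
- exact: (integrableZl measurableT (f 0 - C) igg).
- exact: Lfun2_mul_integrable.
rewrite !RintegralZl// (flux_mean0 fH).
have -> : \int[dx R]_z gg z = 0.
  rewrite Rintegral_dW -[RHS](operator_flux_mean gH) Rintegral_itv_bndo_bndc//.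
  apply: integrableS (Lfun2_dx_integrable lgg) => //.
  by apply: subset_itvl; rewrite bnd_simp.
rewrite -/(dot (dx R) f gg) -/(dot (dW V) D G); lra.
Qed.
End integration_by_parts.

Lemma fine_lebesgue_unit (R : realType) :
  fine (lebesgue_stieltjes_measure idfun `[0%R, 1%R[%classic) = 1 :> R.
Proof. by rewrite -/lebesgue_measure lebesgue_measure_itv/= lte01 sube0. Qed.

Lemma dot_dx_cst1 (R : realType) : dot (dx R) (cst 1) (cst 1) = 1.
Proof.
rewrite /dot Rintegral_dW; under eq_Rintegral do rewrite mulr1.
rewrite Rintegral_cst// mul1r; exact: fine_lebesgue_unit.
Qed.

(** * Growth of the eigenvalues *)

Section eigenvalues.
Context (R : realType) (V : cumulative R R).
Hypotheses (V_incr : {homo V : x y / x < y})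
  (V_periodic : forall u, V (u + 1) - V u = V 1 - V 0).
Variables (e : nat -> R -> R) (lambda b : nat -> R).
Hypotheses (eH : forall j, operator_flux V (e j) (fun x => lambda j * e j x) (b j))
  (eo : forall i j, i != j -> dot (dx R) (e i) (e j) = 0)
  (e01 : forall j, dot (dx R) (e j) (e j) = 1 \/ e j = 0).

Definition eigen_flux j := cut_flux (fun x => lambda j * e j x) (b j).
Local Notation D := eigen_flux.

Let le j : e j \in Lfun (dx R) 2%:E.
Proof. by have [] := operator_flux_Lfun (eH j). Qed.

Lemma Lfun2_eigen_flux j : D j \in Lfun (dW V) 2%:E.
Proof. by apply: Lfun2_cut_flux; have [] := operator_flux_Lfun (eH j). Qed.

Lemma dot_eigen_flux i j :
  dot (dW V) (D i) (D j) = - lambda j * dot (dx R) (e i) (e j).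
Proof.
rewrite (operator_flux_parts V_periodic (eH i) (eH j)) mulNr; congr (- _).
by rewrite (_ : (fun x => _) = lambda j *: e j)// dotZr.
Qed.

(** Equal to [- lambda j] when [e j] is a unit vector and to 0 when [e j] is null; as a square norm
    it is visibly nonnegative. *)
Let nu j := dot (dW V) (D j) (D j).

Let e_const j x : nu j = 0 -> 0 <= x < 1 -> e j x = e j 0.
Proof.
move=> nu0 x01; rewrite (operator_flux_eval (eH j) x01) dotC dot_norm0 ?addr0//.
  exact: Lfun2_eigen_flux.
exact: Lfun2_indic.
Qed.

Let dot_const i j : nu i = 0 -> nu j = 0 -> dot (dx R) (e i) (e j) = e i 0 * e j 0.
Proof.
move=> ni nj; transitivity (dot (dx R) (cst (e i 0)) (cst (e j 0))).
  apply: ae_eq_Rintegral; have := @ae_dW_unit R idfun.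
  apply: filterS; first exact: (ae_filter_ringOfSetsType (dx R)).
  by move=> x; rewrite inE/= in_itv/= => x01; rewrite (e_const ni x01) (e_const nj x01).
have c a : cst a = a *: (cst 1 : R -> R).
  by apply/funext => x; change (a = a * 1); rewrite mulr1.
have l1 := @Lfun2_cst _ _ _ (dx R) 1.
by rewrite (c (e i 0)) (c (e j 0)) dotZl ?Lfun2Z// dotZr// dot_dx_cst1 mulr1.
Qed.

(* A flux of norm zero comes from a constant eigenfunction. *)
Let kernel_unique i j : nu i = 0 -> nu j = 0 -> e i <> 0 -> e j <> 0 -> i = j.
Proof.
move=> ni nj ei ej; apply/eqP/negPn/negP => /eo; rewrite (dot_const ni nj).
have [|//] := e01 i; have [|//] := e01 j.
rewrite (dot_const ni ni) (dot_const nj nj) => jj ii /eqP.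
rewrite mulf_eq0 => /orP[] /eqP z0.
  by move: ii; rewrite z0 mul0r => /esym/eqP; rewrite oner_eq0.
by move: jj; rewrite z0 mul0r => /esym/eqP; rewrite oner_eq0.
Qed.

Let mean0 j : nu j != 0 -> \int[dx R]_x e j x = 0.
Proof.
move=> nuj.
have ij := Lfun2_dx_integrable (le j).
have l0 : lambda j != 0.
  by apply: contra nuj => /eqP l0; rewrite /nu dot_eigen_flux l0 oppr0 mul0r.
have := operator_flux_mean (eH j); rewrite RintegralZl// => /eqP.
rewrite mulf_eq0 (negbTE l0)/= => /eqP e0.
rewrite Rintegral_dW -[RHS]e0 Rintegral_itv_bndo_bndc//.
by apply: integrableS ij => //; apply: subset_itvl; rewrite bnd_simp.
Qed.

(** The inner product of the indicator of []0, x]] with the [j]-th flux is [e j x - e j 0], so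
    Bessel bounds the sum of the [(nu j)^-1 * (e j x - e j 0) ^+ 2] by [V x - V 0]. Integrate over
    [x]: when [nu j] is nonzero, [e j] is a unit vector of mean zero, so subtracting the constant
    [e j 0] can only increase its norm. *)
Let sum_inv n : \sum_(j < n) (nu j)^-1 <= V 1 - V 0.
Proof.
pose v j : R -> R := e j - cst (e j 0).
have lc c := @Lfun2_cst _ _ _ (dx R) c.
have lv j : v j \in Lfun (dx R) 2%:E by exact: Lfun2B.
have iv j := Lfun2_mul_integrable (lv j) (lv j).
have nuv j : (nu j)^-1 <= (nu j)^-1 * dot (dx R) (v j) (v j).
  have [->|nuj] := eqVneq (nu j) 0; first by rewrite invr0 mul0r.
  rewrite ler_peMr// ?invr_ge0 ?dot_ge0// /v dot_subE//.
  have -> : dot (dx R) (e j) (e j) = 1.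
    have [//|ej0] := e01 j; move: nuj.
    by rewrite /nu dot_eigen_flux ej0 dot0l mulr0 eqxx.
  have -> : dot (dx R) (e j) (cst (e j 0)) = 0.
    rewrite /dot RintegralZr//; last exact: Lfun2_integrable.
    by rewrite (mean0 nuj) mul0r.
  by rewrite mulr0 subr0 lerDl dot_ge0.
apply: le_trans (ler_sum _ (fun (j : 'I_n) _ => nuv j)) _.
pose S n x := \sum_(j < n) (nu j)^-1 * v j x ^+ 2.
have [iS ->] : (dx R).-integrable setT (EFin \o S n) /\
    \sum_(j < n) (nu j)^-1 * dot (dx R) (v j) (v j) = \int[dx R]_x S n x.
  elim: n => [|n [iS ES]].
    have S0 : S 0%N = cst 0 by apply/funext => x; rewrite /S big_ord0.
    rewrite S0 big_ord0; split; last by rewrite Rintegral_cst// mul0r.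
    exact: finite_measure_integrable_cst.
  have iv2 : (dx R).-integrable setT (EFin \o (fun x => (nu n)^-1 * (v n x * v n x))).
    exact: (integrableZl measurableT _ (iv n)).
  have SS x : S n.+1 x = S n x + (nu n)^-1 * (v n x * v n x).
    by rewrite /S big_ord_recr/= expr2.
  split.
    apply: eq_integrable (integrableD measurableT iS iv2) => // x _.
    by rewrite /= SS.
  rewrite big_ord_recr/= ES -RintegralZl// -RintegralD//.
  by apply: eq_Rintegral => x _; rewrite SS.
have [mS {}iS] := (integrable_dW _ _).1 iS.
rewrite Rintegral_dW.
have -> : V 1 - V 0 =
    \int[lebesgue_stieltjes_measure idfun]_(x in `[0, 1[) cst (V 1 - V 0) x.
  by rewrite Rintegral_cst//= [X in _ * X]fine_lebesgue_unit mulr1.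
have [_ ic] := (integrable_dW _ _).1 (Lfun2_integrable (lc (V 1 - V 0))).
apply: le_Rintegral => // x; rewrite /= in_itv/= => /andP[x0 x1].
have lx : (\1_(`]0, x]) : R -> R) \in Lfun (dW V) 2%:E by exact: Lfun2_indic.
have Do i j : i != j -> dot (dW V) (D i) (D j) = 0.
  by move=> ij; rewrite dot_eigen_flux eo ?mulr0.
have := bessel_orthogonal n Lfun2_eigen_flux Do lx.
have -> : dot (dW V) (\1_(`]0, x])) (\1_(`]0, x])) = V x - V 0.
  transitivity (\int[dW V]_y (\1_(`]0, x]) y : R)).
    by apply: eq_Rintegral => y _; rewrite indicE; case: (_ \in _); rewrite ?mulr1 ?mulr0.
  have E := dW_itv_oc V (lexx 0) x0 x1.
  by rewrite /Rintegral integral_indic// setIT [X in fine X]E.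
have Vx : V x - V 0 <= V 1 - V 0 by rewrite lerD2r ltW// V_incr.
move=> h; apply: le_trans Vx; apply: le_trans h; rewrite le_eqVlt; apply/orP; left.
apply/eqP/eq_bigr => j _; congr (_ * _ ^+ 2).
rewrite dotC -[LHS]/(e j x - e j 0).
by rewrite (operator_flux_eval (eH j) (x := x)) ?x0// addrC addKr.
Qed.

Lemma eigenvalues_cvg_infty K :
  exists N, forall j, (N <= j)%N -> e j = 0 \/ K < nu j.
Proof.
have /cvg_series_cvg_0 c0 : cvgn (series (fun j => (nu j)^-1)).
  apply: nondecreasing_is_cvgn.
    by apply: nondecreasing_series => j _ _; rewrite invr_ge0 dot_ge0.
  by exists (V 1 - V 0) => _ [n _ <-]; rewrite /series/= big_mkord; exact: sum_inv.
have K1 : 0 < `|K| + 1 by rewrite ltr_wpDl.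
have K1' : 0 < (`|K| + 1)^-1 by rewrite invr_gt0.
have /cvgrPdist_lt/(_ _ K1')[N1 _ hN1] := c0.
(* A small inverse may also come from [nu j = 0], as the inverse of 0 is 0. At most one nonzero
   [e j] is of this kind, and [N2] is taken past it. *)
have [N2 hN2] : exists N2, forall j, (N2 <= j)%N -> nu j = 0 -> e j = 0.
  have [[j0 [n0 ej0]]|none] := pselect (exists j0, nu j0 = 0 /\ e j0 <> 0).
    exists j0.+1 => j jj0 nj; apply: contrapT => ej.
    by move: jj0; rewrite (kernel_unique nj n0 ej ej0) ltnn.
  by exists 0%N => j _ nj; apply: contrapT => ej; apply: none; exists j.
exists (maxn N1 N2) => j; rewrite geq_max => /andP[/hN1 + /hN2 nj0] /=.
rewrite sub0r normrN ger0_norm ?invr_ge0 ?dot_ge0// => nK.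
have [/nj0|nj] := eqVneq (nu j) 0; [by left|right].
have np : 0 < nu j by rewrite lt_neqAle eq_sym nj dot_ge0.
move: nK; rewrite ltf_pV2 ?posrE// => nK.
by rewrite (le_lt_trans (ler_norm K))// (lt_trans _ nK)// ltrDl.
Qed.
End eigenvalues.

(** * The embedding *)

Section enumeration.
Context (R : realType) (V : cumulative R R).

Lemma opLW0 : opLW V 0 (fun x => 0 * (0 : R -> R) x).
Proof.
have E : (fun x => 0 * (0 : R -> R) x) = cst 0 :> (R -> R).
  by apply/funext => x; rewrite mul0r.
have I0 (m : {measure set (measurableTypeR R) -> \bar R}) (B : set (measurableTypeR R)) :
    measurable B -> \int[m]_(y in B) cst 0 y = 0.
  by move=> mB; rewrite Rintegral_cst// mul0r.
have I1 (m : {measure set (measurableTypeR R) -> \bar R})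
    (B : set (measurableTypeR R)) (c : R) :
    measurable B -> c = 0 ->
    \int[m]_(y in B) (c + \int[@lebesgue_measure R]_(z in `[0, y]) cst 0 z) = 0.
  move=> mB ->; under eq_Rintegral do rewrite I0// addr0.
  exact: I0.
rewrite E; split.
- exact: Lfun2_0.
- exact: Lfun2_0.
- by [].
- exact: I0.
- exists 0, 0; split; first exact: I1.
  move=> x _; rewrite mul0r !add0r; apply/esym.
  under eq_Rintegral do rewrite I0//; exact: I0.
Qed.

(* The indices outside the range of the enumeration of [A] are sent to the null
   function, which satisfies every equation of an eigenfunction but its norm. *)
Lemma eigenbasis_enum (A : set (R -> R)) : eigenbasis V A ->
  exists (e : nat -> R -> R) (lambda b : nat -> R),
  [/\ forall j, operator_flux V (e j) (fun x => lambda j * e j x) (b j),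
      forall i j, i != j -> dot (dx R) (e i) (e j) = 0,
      forall j, dot (dx R) (e j) (e j) = 1 \/ e j = 0,
      forall j, e j <> 0 -> A (e j) &
      forall h, h \in Lfun (dx R) 2%:E ->
        (forall j, dot (dx R) (e j) h = 0) -> dot (dx R) h h = 0].
Proof.
move=> [/countable_injP[idx inj_idx] [A2 A1 Ao Atot] Aeig].
pose e j := xget (0 : R -> R) [set g | A g /\ idx g = j].
have eP j : (A (e j) /\ idx (e j) = j) \/ e j = 0.
  by rewrite /e; case: xgetP => [g -> []|]; [left|right].
have eidx g : A g -> e (idx g) = g.
  move=> Ag; rewrite /e; case: xgetP => [g' _ [Ag' gg']|/(_ g)]; last by case.
  by apply: inj_idx => //; rewrite inE.
have : forall j, exists lb : R * R, operator_flux V (e j) (fun x => lb.1 * e j x) lb.2.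
  move=> j; have [[Aj _]|->] := eP j.
    have [_ [l /opLW_operator_flux[b H]]] := Aeig _ Aj.
    by exists (l, b).
  by have [b H] := opLW_operator_flux opLW0; exists (0, b).
move=> /choice[lb lbP]; exists e, (fst \o lb), (snd \o lb); split.
- exact: lbP.
- move=> i j ij; have [[Ai ii]|->] := eP i; last by rewrite dot0l.
  have [[Aj jj]|->] := eP j; last by rewrite dotC dot0l.
  apply: Ao => // eij; move: ij; rewrite -ii -jj eij; exact/negP/negPn.
- by move=> j; have [[Aj _]|] := eP j; [left; exact: A1|right].
- by move=> j ej; have [[]|] := eP j.
- move=> h lh h0; have /(Atot h lh) hae : forall g, A g -> \int[dx R]_x (g x * h x) = 0.
    by move=> g Ag; have := h0 (idx g); rewrite eidx.
  transitivity (\int[dx R]_x (cst 0 x : R)); last by rewrite Rintegral_cst// mul0r.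
  apply: ae_eq_Rintegral; move: hae; apply: filterS.
    exact: (ae_filter_ringOfSetsType (dx R)).
  by move=> x ->; rewrite mul0r.
Qed.
End enumeration.

(** * Derivatives of tensor products *)

Section derivatives.
Context (R : realType) (d : nat).
Implicit Types (phi : 'I_d -> R -> R) (x : torus R d) (i : 'I_d).

Lemma tensor_translate phi x i h :
  tensor phi (translate x i h) =
  phi i (tnth x i + h) * \prod_(k < d | k != i) phi k (tnth x k).
Proof.
rewrite /tensor (bigD1 i)//= tnth_mktuple eqxx mulr1n; congr (_ * _).
by apply: eq_bigr => k /negbTE ki; rewrite tnth_mktuple ki mulr0n addr0.
Qed.

Lemma tensorE phi x i :
  tensor phi x = phi i (tnth x i) * \prod_(k < d | k != i) phi k (tnth x k).
Proof. by rewrite /tensor (bigD1 i). Qed.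

Lemma gderive_tensor (V : R -> R) phi x i (l : R) :
  (phi i (tnth x i + h) - phi i (tnth x i)) / (V (tnth x i + h) - V (tnth x i))
    @[h --> 0^'] --> l ->
  gderive V i (tensor phi) x = l * \prod_(k < d | k != i) phi k (tnth x k).
Proof.
move=> phil; apply/cvg_lim; first exact: Rhausdorff.
under eq_cvg do rewrite tensor_translate (tensorE phi x i) -mulrBl mulrAC.
exact: cvgMl.
Qed.

Variables (W : 'I_d -> cumulative R R).
Hypotheses (W_incr : forall k, {homo W k : x y / x < y})
  (W_periodic : forall k u, W k (u + 1) - W k u = W k 1 - W k 0).
Variables (phi : 'I_d -> R -> R) (lambda b : 'I_d -> R).
Hypothesis phiH : forall k,
  operator_flux (W k) (phi k) (fun y => lambda k * phi k y) (b k).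

(** The derivative of [tensor phi] in direction [i], kept as a tensor so that integrability and
    inner products are read off the factors. *)
Definition flux_tensor i : torus R d -> R :=
  tensor (fun k => if k == i then cut_flux (fun y => lambda i * phi i y) (b i) else phi k).

Lemma flux_tensorE i x : flux_tensor i x =
  cut_flux (fun y => lambda i * phi i y) (b i) (tnth x i) *
  \prod_(k < d | k != i) phi k (tnth x k).
Proof.
rewrite /flux_tensor (tensorE _ x i) eqxx; congr (_ * _).
by apply: eq_bigr => k /negbTE ->.
Qed.

Lemma partialW_tensor i x : 0 <= tnth x i < 1 ->
  partialW W i (tensor phi) x = flux_tensor i x.
Proof.
move=> x01; rewrite flux_tensorE cut_fluxE//; apply: gderive_tensor.
exact: operator_flux_quotient.
Qed.

Lemma ae_partialW_tensor i :
  {ae dxW W i, forall x, partialW W i (tensor phi) x = flux_tensor i x}.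
Proof.
have := @ae_tnth _ _ _ d (fun j => if j == i then dW (W i) else dx R)
  (fun=> `[0, 1[%classic).
have aeu k : {ae (if k == i then dW (W i) else dx R), forall y, `[0, 1[%classic y}.
  have aeu (V : cumulative R R) : {ae dW V, forall y, `[0, 1[%classic y}.
    have := @ae_dW_unit R V; apply: filterS; first exact: (ae_filter_ringOfSetsType (dW V)).
    by move=> y; rewrite inE.
  by case: ifP => _; exact: aeu.
move=> /(_ aeu); apply: filterS => x x01.
by apply: partialW_tensor; have := x01 i; rewrite /= in_itv.
Qed.

(** The outer quotient samples the inner derivative along a line, which an almost everywhere formula
    would not control. [partialW_tensor] holds at every point whose [i]-th coordinate is in [[0,
    1[], and an interior coordinate stays there under small increments. *)
Lemma ae_partialx_partialW_tensor i :
  {ae dx_torus R d, forall x,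
    partialx i (partialW W i (tensor phi)) x = lambda i * tensor phi x}.
Proof.
have [_ lff] := operator_flux_Lfun (phiH i).
pose P k y := 0 < y < 1 /\ (k = i ->
  (flux (b i) (fun y => lambda i * phi i y) (y + h) -
    flux (b i) (fun y => lambda i * phi i y) y) / h @[h --> 0^'] --> lambda i * phi i y).
have aeP k : {ae dx R, forall y, P k y}.
  have := flux_derivative (b i) lff; have := @dW_itv_open R.
  apply: filterS2; first exact: (ae_filter_ringOfSetsType (dx R)).
  by move=> y y01 dy; split.
have := @ae_tnth _ _ _ d (fun=> dx R) P aeP; apply: filterS => x xP.
have [/andP[x0 x1] /(_ erefl) dxi] := xP i.
rewrite (tensorE phi x i) mulrA; apply/cvg_lim; first exact: Rhausdorff.
set Pr := \prod_(k < d | k != i) _.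
set q := (q in (q h) @[h --> _] --> _) in dxi.
have : q h * Pr @[h --> 0^'] --> lambda i * phi i (tnth x i) * Pr by exact: cvgMl.
rewrite /q /Pr.
apply: cvg_trans; apply: near_eq_cvg; near=> h.
have hx : `|h| < tnth x i by near: h; apply: dnbhs0_lt.
have h1x : `|h| < 1 - tnth x i by near: h; apply: dnbhs0_lt; rewrite subr_gt0.
have yh : 0 <= tnth x i + h < 1.
  by move: hx h1x; rewrite !ltr_norml => /andP[? ?] /andP[? ?]; lra.
have tE : tnth (translate x i h) i = tnth x i + h.
  by rewrite tnth_mktuple eqxx mulr1n.
have tk : \prod_(k < d | k != i) phi k (tnth (translate x i h) k) =
    \prod_(k < d | k != i) phi k (tnth x k).
  by apply: eq_bigr => k /negbTE ki; rewrite tnth_mktuple ki mulr0n addr0.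
have x01 : 0 <= tnth x i < 1 by rewrite (ltW x0) x1.
rewrite (partialW_tensor x01) (@partialW_tensor i (translate x i h)) ?tE//.
rewrite !flux_tensorE tk tE !cut_fluxE//.
rewrite /coord -mulrBl mulrAC; congr (_ * _ / _).
by rewrite /=; ring.
Unshelve. all: by end_near. Qed.
End derivatives.

(** * The L^2 norm through [dot] *)

Section cvg_L2.
Context (R : realType) (d : nat).

Lemma Lnorm2_dot (f : torus R d -> R) : f \in Lfun (dx_torus R d) 2%:E ->
  ('N[dx_torus R d]_2%:E[EFin \o f] = (Num.sqrt (dot (dx_torus R d) f f))%:E)%E.
Proof.
move=> lf; rewrite unlock /Lnorm.
have -> : (\int[dx_torus R d]_x `|(EFin \o f) x| `^ 2 = (dot (dx_torus R d) f f)%:E)%E.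
  rewrite /dot /Rintegral fineK; last first.
    by apply: integrable_fin_num => //; exact: (Lfun2_mul_integrable lf lf).
  apply: eq_integral => x _; rewrite /= powR_mulrn// -expr2 real_normK//.
  exact: num_real.
by rewrite poweR_EFin powR12_sqrt// dot_ge0.
Qed.

Lemma cvg_L2_dot (u : nat -> torus R d -> R) h :
  (forall n, u n \in Lfun (dx_torus R d) 2%:E) -> h \in Lfun (dx_torus R d) 2%:E ->
  (forall e, 0 < e -> exists N, forall n, (N <= n)%N ->
    dot (dx_torus R d) (u n - h) (u n - h) <= e) ->
  cvg_L2 u h.
Proof.
move=> lu lh uh; rewrite /cvg_L2.
have E n : ('N[dx_torus R d]_2%:E[(fun x => (u n x - h x)%:E)])%E =
    (Num.sqrt (dot (dx_torus R d) (u n - h) (u n - h)))%:E.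
  by rewrite -Lnorm2_dot//; exact: Lfun2B.
under eq_cvg do rewrite E.
apply/fine_cvgP; split; first exact: nearW.
apply/cvgrPdist_le => e e0; have [N hN] := uh _ (exprn_gt0 2 e0).
exists N => // n /= Nn; rewrite sub0r normrN ger0_norm ?sqrtr_ge0//.
by rewrite -(ger0_norm (ltW e0)) -sqrtr_sqr ler_wsqrtr// hN.
Qed.
End cvg_L2.

(** * Fourier coefficients of Sobolev functions and compactness *)

Section embedding.
Context (R : realType) (d : nat) (W : 'I_d -> cumulative R R).
Hypotheses (W_incr : forall k, {homo W k : x y / x < y})
  (W_periodic : forall k u, W k (u + 1) - W k u = W k 1 - W k 0).
Variables (A : 'I_d -> set (R -> R)).
Variables (e : 'I_d -> nat -> R -> R) (lambda b : 'I_d -> nat -> R).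
Hypotheses
  (eH : forall k j, operator_flux (W k) (e k j) (fun x => lambda k j * e k j x) (b k j))
  (eo : forall k i j, i != j -> dot (dx R) (e k i) (e k j) = 0)
  (e01 : forall k j, dot (dx R) (e k j) (e k j) = 1 \/ e k j = 0)
  (eA : forall k j, e k j <> 0 -> A k (e k j))
  (e_total : forall k h, h \in Lfun (dx R) 2%:E ->
    (forall j, dot (dx R) (e k j) h = 0) -> dot (dx R) h h = 0).
Local Notation index := {ffun 'I_d -> nat}.
Local Notation dxt := (dx_torus R d).

Let le k j : e k j \in Lfun (dx R) 2%:E.
Proof. by have [] := operator_flux_Lfun (eH k j). Qed.

Definition tensor_eigen (a : index) : torus R d -> R := tensor (fun k => e k (a k)).

Definition tensor_eigen_flux i (a : index) : torus R d -> R :=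
  flux_tensor (fun k => e k (a k)) (fun k => lambda k (a k)) (fun k => b k (a k)) i.

Let Lfun2_tensor_eigen a : tensor_eigen a \in Lfun dxt 2%:E.
Proof. exact: Lfun2_tensor. Qed.

Let Lfun2_factor i (a : index) k :
  (if k == i then cut_flux (fun y => lambda i (a i) * e i (a i) y) (b i (a i))
   else e k (a k))
  \in Lfun (if k == i then dW (W i) else dx R) 2%:E.
Proof. by case: ifP => // _; exact: (Lfun2_eigen_flux (eH i) (a i)). Qed.

Let Lfun2_tensor_eigen_flux i a : tensor_eigen_flux i a \in Lfun (dxW W i) 2%:E.
Proof. exact: Lfun2_tensor (Lfun2_factor i a). Qed.

Lemma dot_tensor_eigen_flux i a c :
  dot (dxW W i) (tensor_eigen_flux i a) (tensor_eigen_flux i c) =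
  - lambda i (c i) * dot dxt (tensor_eigen a) (tensor_eigen c).
Proof.
rewrite dot_tensor; [|exact: Lfun2_factor..].
rewrite dot_tensor//.
rewrite (bigD1 i)//= [in RHS](bigD1 i)//= eqxx mulrA; congr (_ * _).
  exact: (dot_eigen_flux (W_periodic i) (eH i)).
by apply: eq_bigr => k /negbTE ->.
Qed.

Lemma tensor_eigen_orthogonal a c : a != c ->
  dot dxt (tensor_eigen a) (tensor_eigen c) = 0.
Proof.
move=> ac; have [k ack] : exists k, a k != c k.
  apply/existsP; apply: contraNT ac; rewrite negb_exists => /forallP ac.
  by apply/eqP/ffunP => k; apply/eqP; have := ac k; rewrite negbK.
by rewrite dot_tensor// (bigD1 k)//= eo// mul0r.
Qed.

Lemma tensor_eigen01 a :
  dot dxt (tensor_eigen a) (tensor_eigen a) = 1 \/ tensor_eigen a = 0.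
Proof.
have [[k ek]|none] := pselect (exists k, e k (a k) = 0).
  by right; apply/funext => x; rewrite /tensor_eigen /tensor (bigD1 k)//= ek mul0r.
left; rewrite dot_tensor// big1// => k _; have [//|ek] := e01 k (a k).
by exfalso; apply: none; exists k.
Qed.

Lemma tensor_eigen_D_W a : tensor_eigen a <> 0 -> D_W A (tensor_eigen a).
Proof.
move=> a0; exists 1%N, (fun=> 1), (fun=> tensor_eigen a); split.
  move=> _; exists (fun k => e k (a k)) => // k; apply: eA => ek; apply: a0.
  by apply/funext => x; rewrite /tensor_eigen /tensor (bigD1 k)//= ek mul0r.
by apply/funext => x; rewrite big_ord1 mul1r.
Qed.

(** The equation of the weak derivative tested on [tensor_eigen a]. When this tensor is nonzero,
    none of its factors is a padding function, so it belongs to [D_W A]. *)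
Lemma weak_partialW_coef i g G a : g \in Lfun dxt 2%:E ->
  weak_partialW W A i g G -> tensor_eigen a <> 0 ->
  dot (dxW W i) (tensor_eigen_flux i a) G =
  - lambda i (a i) * dot dxt (tensor_eigen a) g.
Proof.
move=> lg [_ wG] a0; apply: oppr_inj; have := wG _ (tensor_eigen_D_W a0).
rewrite (ae_eq_Rintegral (g := fun x => lambda i (a i) * (tensor_eigen a x * g x))).
  rewrite mulNr opprK RintegralZl//; last exact: Lfun2_mul_integrable.
  move=> ->; congr (- _); apply: ae_eq_Rintegral.
  have := ae_partialW_tensor W_incr W_periodic (fun k => eH k (a k)) i.
  by apply: filterS => x ->.
have := ae_partialx_partialW_tensor W_incr W_periodic (fun k => eH k (a k)) i.
by apply: filterS => x ->; rewrite mulrA.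
Qed.

(** Multi-indices are finite functions, hence countable, and are listed by their codes; integers
    that code nothing give the null function. *)
Definition eigen_seq n : torus R d -> R :=
  if pickle_inv n is Some a then tensor_eigen a else 0.

Definition flux_seq i n : torus R d -> R :=
  if pickle_inv n is Some a then tensor_eigen_flux i a else 0.

Let energy i n := dot (dxW W i) (flux_seq i n) (flux_seq i n).

Let index_neq m n (a c : index) : m != n ->
  pickle_inv m = Some a -> pickle_inv n = Some c -> a != c.
Proof.
move=> mn ma nc; apply: contraNneq mn => ac; move: nc; rewrite -ac => na.
have := @pickle_invK index m; have := @pickle_invK index n.
by rewrite /= ma na/= => -> ->.
Qed.

Let Lfun2_eigen_seq n : eigen_seq n \in Lfun dxt 2%:E.
Proof. by rewrite /eigen_seq; case: pickle_inv => // ; exact: Lfun2_0. Qed.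

Let Lfun2_flux_seq i n : flux_seq i n \in Lfun (dxW W i) 2%:E.
Proof. by rewrite /flux_seq; case: pickle_inv => // ; exact: Lfun2_0. Qed.

Let eigen_seq_orthogonal m n : m != n -> dot dxt (eigen_seq m) (eigen_seq n) = 0.
Proof.
move=> mn; rewrite /eigen_seq.
case ma : (pickle_inv m) => [a|]; last by rewrite dot0l.
case nc : (pickle_inv n) => [c|]; last by rewrite dotC dot0l.
exact/tensor_eigen_orthogonal/(index_neq mn ma nc).
Qed.

Let flux_seq_orthogonal i m n : m != n -> dot (dxW W i) (flux_seq i m) (flux_seq i n) = 0.
Proof.
move=> mn; rewrite /flux_seq.
case ma : (pickle_inv m) => [a|]; last by rewrite dot0l.
case nc : (pickle_inv n) => [c|]; last by rewrite dotC dot0l.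
by rewrite dot_tensor_eigen_flux tensor_eigen_orthogonal ?mulr0// (index_neq mn ma nc).
Qed.

Let eigen_seq_total h : h \in Lfun dxt 2%:E ->
  (forall n, dot dxt (eigen_seq n) h = 0) -> dot dxt h h = 0.
Proof.
move=> lh h0; apply: (@tensor_total _ _ _ d (fun=> dx R) e) => // a.
rewrite -(h0 (pickle [ffun k => a k])) /eigen_seq pickleK_inv.
apply: eq_Rintegral => x _; congr (_ * _).
by apply: eq_bigr => k _; rewrite ffunE.
Qed.

(** For a unit [tensor_eigen a], the flux has square norm [nu] equal to [- lambda i (a i)] and its
    inner product with [G] is [nu] times the coefficient of [g]. The Bessel term
    [nu^-1 * (nu * coefficient) ^+ 2] is therefore [nu * coefficient ^+ 2]. *)
Lemma energy_bound i g G n : g \in Lfun dxt 2%:E -> weak_partialW W A i g G ->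
  \sum_(j < n) energy i j * dot dxt (eigen_seq j) g ^+ 2 <= dot (dxW W i) G G.
Proof.
move=> lg wG; have [[lG _] _] := wG.
apply: le_trans (bessel_orthogonal n (Lfun2_flux_seq i) (@flux_seq_orthogonal i) lG).
rewrite le_eqVlt; apply/orP; left; apply/eqP/eq_bigr => j _.
rewrite /energy /eigen_seq /flux_seq; case: pickle_inv => [a|]; last first.
  by rewrite !dot0l mul0r invr0 mul0r.
have [a0|a0] := pselect (tensor_eigen a = 0).
  by rewrite dot_tensor_eigen_flux a0 !dot0l !mulr0 invr0 !mul0r.
rewrite dot_tensor_eigen_flux (weak_partialW_coef lg wG a0).
have [->|//] := tensor_eigen01 a; rewrite mulr1.
have [->|l0] := eqVneq (lambda i (a i)) 0; first by rewrite oppr0 invr0 !mul0r.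
by field.
Qed.

(** The direction [i] depends on [n]: a mode may oscillate in one coordinate and be constant in the
    others. *)
Lemma energy_cvg_infty K :
  exists N, forall n, (N <= n)%N -> eigen_seq n = 0 \/ exists i, K < energy i n.
Proof.
have /choice[N hN] : forall k, exists N, forall j, (N <= j)%N -> e k j = 0 \/
    K < dot (dW (W k)) (eigen_flux (e k) (lambda k) (b k) j)
                       (eigen_flux (e k) (lambda k) (b k) j).
  move=> k; exact: (eigenvalues_cvg_infty (W_incr k) (W_periodic k) (eH k) (@eo k) (e01 k)).
pose M := (\max_k N k)%N.
(* This bound exceeds the codes of all multi-indices with entries below [M]; any later one has an
   entry at least [M], hence beyond the threshold of its coordinate. *)
exists (\max_(c : {ffun 'I_d -> 'I_M}) pickle [ffun k => c k : nat]).+1 => n nM.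
rewrite /eigen_seq /energy /flux_seq; case na : (pickle_inv n) => [a|]; last by left.
have [a0|a0] := pselect (tensor_eigen a = 0); [by left|right].
have [k Mk] : exists k, (M <= a k)%N.
  apply/existsP; apply: contraLR nM; rewrite negb_exists => /forallP aM.
  have {}aM k : (a k < M)%N by rewrite ltnNge aM.
  rewrite -leqNgt; pose c := [ffun k => Ordinal (aM k)].
  have := @pickle_invK index n; rewrite /= na/= => <-.
  rewrite (_ : a = [ffun k => c k : nat]); last by apply/ffunP => k; rewrite !ffunE.
  exact: (leq_bigmax c).
exists k; have [ek|] := hN k (a k) (leq_trans (leq_bigmax k) Mk).
  exfalso; apply: a0; apply/funext => x.
  by rewrite /tensor_eigen /tensor (bigD1 k)//= ek mul0r.
rewrite dot_tensor_eigen_flux dot_eigen_flux//.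
have [->|//] := tensor_eigen01 a.
have [->//|ek] := e01 k (a k).
exfalso; apply: a0; apply/funext => x.
by rewrite /tensor_eigen /tensor (bigD1 k)//= ek mul0r.
Qed.

Lemma compact_embedding : H1W_compact_embedding W A.
Proof.
move=> g Dg M gH gD gM.
have lg n : g n \in Lfun dxt 2%:E by have [] := gH n.
have M2 n : dot dxt (g n) (g n) + \sum_(i < d) dot (dxW W i) (Dg n i) (Dg n i) <= M ^+ 2.
  have S0 : 0 <= H1W_dot W (g n) (Dg n) (g n) (Dg n).
    by apply: addr_ge0; [exact: dot_ge0|apply: sumr_ge0 => i _; exact: dot_ge0].
  have := gM n; rewrite /H1W_norm => h.
  rewrite -[leLHS]/(H1W_dot W (g n) (Dg n) (g n) (Dg n)) -(sqr_sqrtr S0).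
  by rewrite ler_sqr ?nnegrE ?sqrtr_ge0// (le_trans _ h)// sqrtr_ge0.
have [|||s [h [sI lh sh]]] := @compact_of_small_tails _ _ _ dxt eigen_seq
    Lfun2_eigen_seq eigen_seq_orthogonal _ eigen_seq_total g (M ^+ 2) lg.
- move=> n; rewrite /eigen_seq; case: pickle_inv => [a|]; last by right.
  exact: tensor_eigen01.
- move=> n; apply: le_trans (M2 n); rewrite lerDl.
  by apply: sumr_ge0 => i _; exact: dot_ge0.
(* [K] times a tail is at most the sum of the square norms of the weak derivatives, so at most
   [M ^+ 2], while [K * eps] is [M ^+ 2 + 1]. The added 1 keeps [K] positive when [M] is 0. *)
- move=> eps e0; pose K := (M ^+ 2 + 1) / eps.
  have M1 : 0 < M ^+ 2 + 1 by rewrite ltr_wpDl ?sqr_ge0.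
  have K0 : 0 < K by rewrite divr_gt0.
  have [N hN] := energy_cvg_infty K; exists N => m n.
  have [mN|Nm] := leqP m N; first by rewrite big_geq// ltW.
  pose E i j := energy i j * dot dxt (eigen_seq j) (g n) ^+ 2.
  rewrite -(ler_pM2l K0).
  apply: (@le_trans _ _ (\sum_(i < d) \sum_(j < m) E i j)).
    rewrite exchange_big/= -(big_mkord xpredT (fun j => \sum_(i < d) E i j)).
    rewrite (@big_cat_nat _ _ _ N 0 m)//=; last exact: ltnW.
    apply: ler_wpDl.
      apply: sumr_ge0 => j _; apply: sumr_ge0 => i _.
      by rewrite mulr_ge0 ?sqr_ge0 ?dot_ge0.
    (* Beyond [N] each nonzero mode has a direction of energy above [K]; summing over all directions
       covers it, whichever one it is. *)
    rewrite mulr_sumr; apply: ler_sum_nat => j /andP[Nj _]; have [ej|[i Ki]] := hN j Nj.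
      rewrite ej dot0l expr0n mulr0; apply: sumr_ge0 => i _.
      by rewrite mulr_ge0 ?sqr_ge0 ?dot_ge0.
    rewrite (bigD1 i)//=; apply: ler_wpDr.
      by apply: sumr_ge0 => k _; rewrite mulr_ge0 ?sqr_ge0 ?dot_ge0.
    by rewrite ler_wpM2r ?sqr_ge0// ltW.
  apply: (@le_trans _ _ (\sum_(i < d) dot (dxW W i) (Dg n i) (Dg n i))).
    by apply: ler_sum => i _; exact: energy_bound.
  have := M2 n; have := dot_ge0 dxt (g n).
  by rewrite /K divfK ?(gt_eqF e0)//; lra.
exists s, h; split => //; apply: cvg_L2_dot => // n; exact: lg.
Qed.
End embedding.

Theorem proposition2p9 (R : realType) (d : nat) (d_gt0 : (0 < d)%N)
    (W : 'I_d -> cumulative R R)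
    (W_increasing : forall k, {homo W k : x y / x < y})
    (W_left_limits : forall k (u : R), cvg (W k x @[x --> u^'-]))
    (W_periodic_increments : forall k (u : R),
       W k (u + 1) - W k u = W k 1 - W k 0)
    (A : 'I_d -> set (R -> R))
    (A_eigenbasis : forall k, eigenbasis (W k) (A k)) :
  H1W_compact_embedding W A.
Proof.
have /choice[e /choice[l /choice[b H]]] := fun k => eigenbasis_enum (A_eigenbasis k).
by apply: (@compact_embedding _ _ _ W_increasing W_periodic_increments A e l b) => k;
  have [] := H k.
Qed.
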